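(* Let $B$ be a cocommutative bialgebra over a field $\Bbbk$. Then the cofree cocommutative Hopf algebra on $B$ is $$\mathrm{C}^c(B)=\Big\{\textstyle\sum_i x^i\otimes y_i\in (B\otimes B)^{\mathrm{co}B} \;\Big|\; \sum_i y_i\otimes x^i\in (B\otimes B)^{\mathrm{co}B}\Big\}\subseteq (B\otimes B)^{\mathrm{co}B},$$ with canonical map $\epsilon_B^c\colon\mathrm{C}^c(B)\to B$ given by the restriction of $p_B\colon (B\otimes B)^{\mathrm{co}B}\to B$.
   Context: For a bialgebra $B$ over a field $\Bbbk$ put $(B\otimes B)^{\mathrm{co}B}:=\{\sum_i x^i\otimes y_i\in B\otimes B \mid \sum_i x^i_1\otimes (y_i)_1\otimes x^i_2(y_i)_2=\sum_i x^i\otimes y_i\otimes 1\}$ and $p_B\colon (B\otimes B)^{\mathrm{co}B}\to B$, $\sum_i x^i\otimes y_i\mapsto\sum_i x^i\varepsilon(y_i)$. When $B$ is cocommutative, $(B\otimes B)^{\mathrm{co}B}$ is a sub-bialgebra of $B\otimes B^{\mathrm{op}}$, and the displayed subspace carries the bialgebra structure of a sub-bialgebra of $B\otimes B^{\mathrm{op}}$. The cofree cocommutative Hopf algebra on a cocommutative bialgebra $B$ is a cocommutative Hopf algebra $\mathrm{C}^c(B)$ with a bialgebra map $\epsilon_B^c\colon\mathrm{C}^c(B)\to B$ such that for every cocommutative Hopf algebra $H$ and every bialgebra map $f\colon H\to B$ there is a unique Hopf algebra map $\tilde f\colon H\to\mathrm{C}^c(B)$ with $\epsilon_B^c\circ\tilde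 f=f$. *)

(* Defs.v *)
From HB Require Import structures.
From mathcomp Require Import all_boot all_order all_algebra generic_quotient.
From mathcomp Require Import boolp sesquilinear.

Set Implicit Arguments.
Unset Strict Implicit.
Unset Printing Implicit Defensive.

Import GRing.Theory.
Local Open Scope ring_scope.
Local Open Scope quotient_scope.

(* U ⊗ V is the monoid of formal sums of pairs (lists, up to permutation)
   modulo the congruence generated by bilinearity; scalars act by
   a · (u ⊗ v) = (a u) ⊗ v.  The universal property is [tlift_tens],
   [tlift_linear] and [tlift_unique] below. *)
Inductive tensor_rel (K : fieldType) (U V : lmodType K) :
    seq (U * V) -> seq (U * V) -> Prop :=
| TRrefl s : tensor_rel s s
| TRsym s t : tensor_rel s t -> tensor_rel t s
| TRtrans s t r : tensor_rel s t -> tensor_rel t r -> tensor_rel s r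
| TRcat s s' t t' :
    tensor_rel s s' -> tensor_rel t t' -> tensor_rel (s ++ t) (s' ++ t')
| TRcatC s t : tensor_rel (s ++ t) (t ++ s)
| TRaddl u u' v : tensor_rel [:: (u + u', v)] [:: (u, v); (u', v)]
| TRaddr u v v' : tensor_rel [:: (u, v + v')] [:: (u, v); (u, v')]
| TRscale a u v : tensor_rel [:: (a *: u, v)] [:: (u, a *: v)]
| TRzero v : tensor_rel [:: (0, v)] [::].

Section TensorType.
Variables (K : fieldType) (U V : lmodType K).

Definition tensor_eqb (s t : seq (U * V)) : bool := `[< tensor_rel s t >].

Lemma tensor_eqb_refl : reflexive tensor_eqb.
Proof. by move=> s; apply/asboolP; apply: TRrefl. Qed.
Lemma tensor_eqb_sym : symmetric tensor_eqb.
Proof. by move=> s t; apply/asboolP/asboolP; apply: TRsym. Qed.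
Lemma tensor_eqb_trans : transitive tensor_eqb.
Proof.
by move=> t s r /asboolP st /asboolP tr; apply/asboolP; apply: TRtrans st tr.
Qed.

Canonical tensor_equiv :=
  EquivRel tensor_eqb tensor_eqb_refl tensor_eqb_sym tensor_eqb_trans.

Definition tensor : Type := {eq_quot tensor_equiv}.
HB.instance Definition _ := Choice.on tensor.
HB.instance Definition _ := EqQuotient.on tensor.

Lemma tensor_quotW (P : tensor -> Prop) :
  (forall s, P (\pi_tensor s)) -> forall x, P x.
Proof. by move=> Ps x; rewrite -[x]reprK. Qed.

Lemma tensorP (s t : seq (U * V)) :
  tensor_rel s t <-> \pi_tensor s = \pi_tensor t.
Proof.
split=> [st|/eqmodP /asboolP//].
by apply/eqmodP; apply/asboolP.
Qed.

Lemma tensor_reprP (s : seq (U * V)) : tensor_rel (repr (\pi_tensor s)) s.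
Proof. by apply/tensorP; rewrite reprK. Qed.

Definition tadd (x y : tensor) : tensor := \pi_tensor (repr x ++ repr y).
Definition tzero : tensor := \pi_tensor [::].
Definition tscale (a : K) (x : tensor) : tensor :=
  \pi_tensor [seq (a *: p.1, p.2) | p <- repr x].
Definition topp (x : tensor) : tensor := tscale (-1) x.

Lemma tadd_pi s t : tadd (\pi_tensor s) (\pi_tensor t) = \pi_tensor (s ++ t).
Proof. by apply/tensorP; apply: TRcat; apply: tensor_reprP. Qed.

Lemma tensor_rel_scale a s t : tensor_rel s t ->
  tensor_rel [seq (a *: p.1, p.2) | p : U * V <- s]
             [seq (a *: p.1, p.2) | p : U * V <- t].
Proof.
elim=> {s t}.
- by move=> s; apply: TRrefl.
- by move=> s t _; apply: TRsym.
- by move=> s t r _ st _; apply: TRtrans st.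
- by move=> s s' t t' _ ? _ ?; rewrite !map_cat; apply: TRcat.
- by move=> s t; rewrite !map_cat; apply: TRcatC.
- by move=> u u' v /=; rewrite scalerDr; apply: TRaddl.
- by move=> u v v'; apply: TRaddr.
- by move=> b u v /=; rewrite scalerA mulrC -scalerA; apply: TRscale.
- by move=> v /=; rewrite scaler0; apply: TRzero.
Qed.

Lemma tscale_pi a s :
  tscale a (\pi_tensor s) = \pi_tensor [seq (a *: p.1, p.2) | p <- s].
Proof. by apply/tensorP; apply: tensor_rel_scale; apply: tensor_reprP. Qed.

Lemma taddA : associative tadd.
Proof.
move=> x y z; elim/tensor_quotW: x => x; elim/tensor_quotW: y => y; elim/tensor_quotW: z => z.
by rewrite !tadd_pi catA.
Qed.
Lemma taddC : commutative tadd.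
Proof. by move=> x y; apply/tensorP; apply: TRcatC. Qed.
Lemma tadd0 : left_id tzero tadd.
Proof. by move=> x; elim/tensor_quotW: x => s; rewrite tadd_pi. Qed.

Lemma tscaleDl x a b : tscale (a + b) x = tadd (tscale a x) (tscale b x).
Proof.
elim/tensor_quotW: x => x; rewrite !tscale_pi tadd_pi; apply/tensorP.
elim: x => [|[u v] s IH] /=; first exact: TRrefl.
rewrite scalerDl.
apply: (TRtrans (t := [:: (a *: u, v); (b *: u, v)] ++
  ([seq (a *: p.1, p.2) | p <- s] ++ [seq (b *: p.1, p.2) | p <- s]))).
  exact: (@TRcat _ _ _ [:: _] _ _ _ (TRaddl _ _ _) IH).
apply: (@TRcat _ _ _ [:: (a *: u, v)] [:: (a *: u, v)]); first exact: TRrefl.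
rewrite -[X in tensor_rel _ X]cat_rcons -cats1.
apply: (@TRcat _ _ _ ((b *: u, v) :: _)); last exact: TRrefl.
exact: (TRcatC [:: _]).
Qed.

Lemma tscale0 x : tscale 0 x = tzero.
Proof.
elim/tensor_quotW: x => x; rewrite tscale_pi; apply/tensorP.
elim: x => [|[u v] s IH] /=; first exact: TRrefl.
by rewrite scale0r; apply: (@TRcat _ _ _ [:: _] [::]) => //; apply: TRzero.
Qed.

Lemma tscale1 : left_id 1 tscale.
Proof.
move=> x; elim/tensor_quotW: x => x; rewrite tscale_pi -[X in _ = \pi_tensor X]map_id.
by congr \pi_tensor; apply: eq_map => -[u v] /=; rewrite scale1r.
Qed.

Lemma taddN : left_inverse tzero topp tadd.
Proof.
by move=> x; rewrite -[X in tadd _ X]tscale1 -tscaleDl addNr tscale0.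
Qed.

HB.instance Definition _ := GRing.isZmodule.Build tensor taddA taddC tadd0 taddN.

Lemma tscaleA a b x : tscale a (tscale b x) = tscale (a * b) x.
Proof.
elim/tensor_quotW: x => x; rewrite !tscale_pi -map_comp.
by congr \pi_tensor; apply: eq_map => -[u v] /=; rewrite scalerA.
Qed.

Lemma tscaleDr : right_distributive tscale +%R.
Proof.
move=> a x y; elim/tensor_quotW: x => x; elim/tensor_quotW: y => y.
by rewrite [_ + _]tadd_pi !tscale_pi [RHS]tadd_pi map_cat.
Qed.

HB.instance Definition _ := GRing.Zmodule_isLmodule.Build K tensor
  tscaleA tscale1 tscaleDr tscaleDl.

Definition tens (u : U) (v : V) : tensor := \pi_tensor [:: (u, v)].

(* Meaningful only for bilinear f. *)
Definition tlift (W : lmodType K) (f : U -> V -> W) (z : tensor) : W :=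
  \sum_(p <- repr z) f p.1 p.2.

End TensorType.

Notation "u ⊗ v" := (tens u v) (at level 40, left associativity) : ring_scope.
Notation bilin f := (bilinear_for *:%R *:%R f).

Section TensorTheory.
Variables (K : fieldType) (U V W : lmodType K).
Implicit Types (u : U) (v : V) (z : tensor U V).

Lemma tensDl u u' v : (u + u') ⊗ v = u ⊗ v + u' ⊗ v.
Proof. by rewrite [RHS]tadd_pi; apply/tensorP; apply: TRaddl. Qed.
Lemma tensDr u v v' : u ⊗ (v + v') = u ⊗ v + u ⊗ v'.
Proof. by rewrite [RHS]tadd_pi; apply/tensorP; apply: TRaddr. Qed.
Lemma tensZl a u v : (a *: u) ⊗ v = a *: (u ⊗ v).
Proof. by rewrite [RHS]tscale_pi. Qed.
Lemma tensZr a u v : u ⊗ (a *: v) = a *: (u ⊗ v).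
Proof. by rewrite -tensZl; apply/esym/tensorP; apply: TRscale. Qed.

Lemma tens_bilin : bilin (@tens K U V).
Proof.
split=> [v a u u'|u a v v'].
- by rewrite /= tensDl tensZl.
- by rewrite tensDr tensZr.
Qed.

Lemma tens_linearr u : linear (tens u : V -> tensor U V).
Proof. exact: (tens_bilin.2 u). Qed.
HB.instance Definition _ u :=
  GRing.isLinear.Build K V (tensor U V) _ (tens u) (tens_linearr u).

Lemma tens0l v : (0 : U) ⊗ v = 0.
Proof. by rewrite -(scale0r (0 : U)) tensZl scale0r. Qed.

Lemma tensorW (P : tensor U V -> Prop) :
  (forall u v, P (u ⊗ v)) -> (forall x y, P x -> P y -> P (x + y)) ->
  forall z, P z.
Proof.
move=> Pt PD z; elim/tensor_quotW: z; elim=> [|[u v] s IH].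
  by rewrite -[\pi_ _ _](tens0l 0).
have -> : \pi_(tensor U V) ((u, v) :: s) = u ⊗ v + \pi_(tensor U V) s.
  by rewrite [RHS]tadd_pi.
exact: PD.
Qed.

Lemma tlift_pi (f : U -> V -> W) s : bilin f ->
  tlift f (\pi_(tensor U V) s) = \sum_(p <- s) f p.1 p.2.
Proof.
case=> fl fr; rewrite /tlift; move: (tensor_reprP s); move: (repr _) => t.
have f0 v : f 0 v = 0.
  by have := fl v (-1) 0 0; rewrite /= scaler0 addr0 scaleN1r addNr.
elim=> {s t} //.
- by move=> s t r _ -> _ ->.
- by move=> s s' t t' _ e1 _ e2; rewrite !big_cat e1 e2.
- by move=> s t; rewrite !big_cat /= addrC.
- move=> u u' v; rewrite !big_cons !big_nil !addr0 /=.
  by have := fl v 1 u u'; rewrite /= !scale1r.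
- move=> u v v'; rewrite !big_cons !big_nil !addr0 /=.
  by have := fr u 1 v v'; rewrite /= !scale1r.
- move=> a u v; rewrite !big_cons !big_nil !addr0 /=.
  have := fl v a u 0; rewrite /= !addr0 f0 addr0 => ->.
  have := fr u a v 0; rewrite /= !addr0 => ->.
  have := fr u (-1) 0 0; rewrite /= scaler0 addr0 scaleN1r addNr => ->.
  by rewrite addr0.
- by move=> v; rewrite big_seq1 big_nil /= f0.
Qed.

Lemma tlift_tens (f : U -> V -> W) u v : bilin f -> tlift f (u ⊗ v) = f u v.
Proof. by move=> bf; rewrite tlift_pi // big_seq1. Qed.

Lemma tlift_linear (f : U -> V -> W) : bilin f -> linear (tlift f).
Proof.
move=> bf a x y; have [fl fr] := bf.
elim/tensor_quotW: x => x; elim/tensor_quotW: y => y; rewrite [_ *: _]tscale_pi [_ + _ in LHS]tadd_pi.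
rewrite !tlift_pi // big_cat big_map scaler_sumr /=; congr (_ + _).
apply: eq_bigr => -[u v] _ /=.
have f0 : f 0 v = 0.
  by have := fl v (-1) 0 0; rewrite /= scaler0 addr0 scaleN1r addNr.
by have := fl v a u 0; rewrite /= !addr0 f0 addr0.
Qed.

Lemma tlift_unique (f g : {linear tensor U V -> W}) :
  (forall u v, f (u ⊗ v) = g (u ⊗ v)) -> f =1 g.
Proof.
by move=> fg; elim/tensorW=> // x y ex ey; rewrite !linearD ex ey.
Qed.

Lemma tlift_param (X : lmodType K) (f : X -> U -> V -> W) z :
  (forall u v, linear (fun x => f x u v)) -> linear (fun x => tlift (f x) z).
Proof.
move=> fl a x y; rewrite /tlift scaler_sumr -big_split /=.
by apply: eq_bigr => p _; apply: fl.
Qed.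

End TensorTheory.

Section TensorMaps.
Variable K : fieldType.

(* f ⊗ g, for linear f and g. *)
Definition tmap (U U' V V' : lmodType K) (f : U -> U') (g : V -> V') :
    tensor U V -> tensor U' V' :=
  tlift (fun u v => f u ⊗ g v).

Lemma tmap_bilin (U U' V V' : lmodType K) (f : {linear U -> U'})
  (g : {linear V -> V'}) : bilin (fun u v => f u ⊗ g v).
Proof.
split=> [v a u u'|u a v v'] /=.
- by rewrite linearP tensDl tensZl.
- by rewrite linearP tensDr tensZr.
Qed.

HB.instance Definition _ (U U' V V' : lmodType K) (f : {linear U -> U'})
    (g : {linear V -> V'}) :=
  GRing.isLinear.Build K (tensor U V) (tensor U' V') _ (tmap f g)
    (tlift_linear (tmap_bilin f g)).

Lemma tmapE (U U' V V' : lmodType K) (f : {linear U -> U'})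
  (g : {linear V -> V'}) u v : tmap f g (u ⊗ v) = f u ⊗ g v.
Proof. exact: tlift_tens (tmap_bilin f g). Qed.

Definition tswap (U V : lmodType K) : tensor U V -> tensor V U :=
  tlift (fun u v => v ⊗ u).

Lemma tswap_bilin (U V : lmodType K) : bilin (fun (u : U) (v : V) => v ⊗ u).
Proof.
split=> [v a u u'|u a v v'] /=.
- by rewrite tensDr tensZr.
- by rewrite tensDl tensZl.
Qed.

HB.instance Definition _ (U V : lmodType K) :=
  GRing.isLinear.Build K (tensor U V) (tensor V U) _ (@tswap U V)
    (tlift_linear (tswap_bilin U V)).

Lemma tswapE (U V : lmodType K) (u : U) (v : V) : tswap (u ⊗ v) = v ⊗ u.
Proof. exact: tlift_tens (tswap_bilin U V). Qed.

(* (u ⊗ v) ⊗ w ↦ u ⊗ (v ⊗ w) *)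
Definition tassoc (U V W : lmodType K) :
    tensor (tensor U V) W -> tensor U (tensor V W) :=
  tlift (fun p w => tlift (fun u v => u ⊗ (v ⊗ w)) p).

Section Assoc.
Variables U V W : lmodType K.
Lemma tassoc_bilin1 (w : W) : bilin (fun (u : U) (v : V) => u ⊗ (v ⊗ w)).
Proof.
split=> [v a u u'|u a v v'] /=.
- by rewrite tensDl tensZl.
- by rewrite tensDl tensZl tensDr tensZr.
Qed.
Lemma tassoc_bilin : bilin (fun (p : tensor U V) (w : W) =>
  tlift (fun u v => u ⊗ (v ⊗ w)) p).
Proof.
split=> [w|p]; first exact: tlift_linear (tassoc_bilin1 w).
apply: tlift_param => u v a w w' /=.
by rewrite tensDr tensZr tensDr tensZr.
Qed.
HB.instance Definition _ :=
  GRing.isLinear.Build K (tensor (tensor U V) W) (tensor U (tensor V W)) _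
    (@tassoc U V W) (tlift_linear tassoc_bilin).
Lemma tassocE (u : U) (v : V) (w : W) : tassoc (u ⊗ v ⊗ w) = u ⊗ (v ⊗ w).
Proof.
by rewrite [LHS](tlift_tens _ _ tassoc_bilin) (tlift_tens _ _ (tassoc_bilin1 w)).
Qed.
End Assoc.

(* (a ⊗ b) ⊗ (c ⊗ d) ↦ (a ⊗ c) ⊗ (b ⊗ d) *)
Definition tmid (A B C D : lmodType K) :
    tensor (tensor A B) (tensor C D) -> tensor (tensor A C) (tensor B D) :=
  tlift (fun p q =>
    tlift (fun a b => tlift (fun c d => (a ⊗ c) ⊗ (b ⊗ d)) q) p).

Section Mid.
Variables A B C D : lmodType K.
Lemma tmid_bilin1 (a : A) (b : B) :
  bilin (fun (c : C) (d : D) => (a ⊗ c) ⊗ (b ⊗ d)).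
Proof.
split=> [v e u u'|u e v v'] /=.
- by rewrite tensDr tensZr tensDl tensZl.
- by rewrite (tensDr b) tensZr tensDr tensZr.
Qed.
Lemma tmid_bilin2 (q : tensor C D) : bilin (fun (a : A) (b : B) =>
  tlift (fun c d => (a ⊗ c) ⊗ (b ⊗ d)) q).
Proof.
split=> [v|u]; apply: tlift_param => c d e x y.
- by rewrite tensDl tensZl tensDl tensZl.
- by rewrite tensDl tensZl tensDr tensZr.
Qed.
Lemma tmid_bilin : bilin (fun (p : tensor A B) (q : tensor C D) =>
  tlift (fun a b => tlift (fun c d => (a ⊗ c) ⊗ (b ⊗ d)) q) p).
Proof.
split=> [q|p]; first exact: tlift_linear (tmid_bilin2 q).
apply: tlift_param => a b; exact: tlift_linear (tmid_bilin1 a b).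
Qed.
HB.instance Definition _ :=
  GRing.isLinear.Build K (tensor (tensor A B) (tensor C D))
    (tensor (tensor A C) (tensor B D)) _
    (@tmid A B C D) (tlift_linear tmid_bilin).
Lemma tmidE (a : A) (b : B) (c : C) (d : D) :
  tmid ((a ⊗ b) ⊗ (c ⊗ d)) = (a ⊗ c) ⊗ (b ⊗ d).
Proof.
by rewrite [LHS](tlift_tens _ _ tmid_bilin) (tlift_tens _ _ (tmid_bilin2 _))
  (tlift_tens _ _ (tmid_bilin1 _ _)).
Qed.
End Mid.

Definition tmul (A : algType K) : tensor A A -> A := tlift *%R.

Section Mul.
Variable A : algType K.
Lemma tmul_bilin : bilin ( *%R : A -> A -> A).
Proof.
split=> [v a u u'|u a v v'] /=.
- by rewrite mulrDl scalerAl.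
- by rewrite mulrDr scalerAr.
Qed.
HB.instance Definition _ :=
  GRing.isLinear.Build K (tensor A A) A _ (@tmul A) (tlift_linear tmul_bilin).
Lemma tmulE (a b : A) : tmul (a ⊗ b) = a * b.
Proof. exact: tlift_tens tmul_bilin. Qed.
End Mul.

(* φ ⊗ id and id ⊗ φ, for a linear form φ. *)
Definition tcontractl (U V : lmodType K) (phi : U -> K) : tensor U V -> V :=
  tlift (fun u v => phi u *: v).
Definition tcontractr (U V : lmodType K) (phi : V -> K) : tensor U V -> U :=
  tlift (fun u v => phi v *: u).

Section Contract.
Variables U V : lmodType K.
Lemma tcontractl_bilin (phi : {scalar U}) : bilin (fun u (v : V) => phi u *: v).
Proof.
split=> [v a u u'|u a v v'] /=.
- by rewrite linearP /= scalerDl scalerA.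
- by rewrite scalerDr !scalerA mulrC.
Qed.
HB.instance Definition _ (phi : {scalar U}) :=
  GRing.isLinear.Build K (tensor U V) V _ (tcontractl phi)
    (tlift_linear (tcontractl_bilin phi)).
Lemma tcontractlE (phi : {scalar U}) u (v : V) :
  tcontractl phi (u ⊗ v) = phi u *: v.
Proof. exact: tlift_tens (tcontractl_bilin phi). Qed.
Lemma tcontractr_bilin (phi : {scalar V}) :
  bilin (fun (u : U) (v : V) => phi v *: u).
Proof.
split=> [v a u u'|u a v v'] /=.
- by rewrite scalerDr !scalerA mulrC.
- by rewrite linearP /= scalerDl scalerA.
Qed.
HB.instance Definition _ (phi : {scalar V}) :=
  GRing.isLinear.Build K (tensor U V) U _ (tcontractr phi)
    (tlift_linear (tcontractr_bilin phi)).
Lemma tcontractrE (phi : {scalar V}) (u : U) v :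
  tcontractr phi (u ⊗ v) = phi v *: u.
Proof. exact: tlift_tens (tcontractr_bilin phi). Qed.
End Contract.

End TensorMaps.

(* The algebra A ⊗ B, with (a ⊗ b)(c ⊗ d) = ac ⊗ bd. *)
Section TensorAlgebra.
Variables (K : fieldType) (A B : algType K).
Implicit Types x y z : tensor A B.

Definition tensor_mul x y : tensor A B := tmap (@tmul K A) (@tmul K B) (tmid (x ⊗ y)).
Definition tensor_one : tensor A B := 1 ⊗ 1.

Lemma tensor_mulE (a c : A) (b d : B) :
  tensor_mul (a ⊗ b) (c ⊗ d) = (a * c) ⊗ (b * d).
Proof. by rewrite /tensor_mul tmidE tmapE /= !tmulE. Qed.

Lemma tensor_mulDl : left_distributive tensor_mul +%R.
Proof. by move=> x y z; rewrite /tensor_mul tensDl !linearD. Qed.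
Lemma tensor_mulDr : right_distributive tensor_mul +%R.
Proof. by move=> x y z; rewrite /tensor_mul tensDr !linearD. Qed.
Lemma tensor_scalerAl (a : K) x y : a *: tensor_mul x y = tensor_mul (a *: x) y.
Proof. by rewrite /tensor_mul tensZl !linearZ. Qed.
Lemma tensor_scalerAr (a : K) x y : a *: tensor_mul x y = tensor_mul x (a *: y).
Proof. by rewrite /tensor_mul tensZr !linearZ. Qed.

Lemma tensor_mulA : associative tensor_mul.
Proof.
move=> x y z.
elim/tensorW: x => [a b|x x' IH IH']; last by rewrite !tensor_mulDl IH IH'.
elim/tensorW: y => [c d|y y' IH IH'];
  last by rewrite !(tensor_mulDl, tensor_mulDr) IH IH'.
elim/tensorW: z => [e f|z z' IH IH']; last by rewrite !tensor_mulDr IH IH'.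
by rewrite !tensor_mulE !mulrA.
Qed.
Lemma tensor_mul1 : left_id tensor_one tensor_mul.
Proof.
by elim/tensorW=> [a b|x y ex ey];
  rewrite ?tensor_mulE ?mul1r // tensor_mulDr ex ey.
Qed.
Lemma tensor_1mul : right_id tensor_one tensor_mul.
Proof.
by elim/tensorW=> [a b|x y ex ey];
  rewrite ?tensor_mulE ?mulr1 // tensor_mulDl ex ey.
Qed.

HB.instance Definition _ := GRing.Zmodule_isPzRing.Build (tensor A B)
  tensor_mulA tensor_mul1 tensor_1mul tensor_mulDl tensor_mulDr.

Lemma tensM (a c : A) (b d : B) : (a ⊗ b) * (c ⊗ d) = (a * c) ⊗ (b * d).
Proof. exact: tensor_mulE. Qed.
Lemma tens1 : 1 = (1 : A) ⊗ (1 : B).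
Proof. by []. Qed.
End TensorAlgebra.

HB.mixin Record isCoalgebra (K : fieldType) C of GRing.Lmodule K C := {
  comul : C -> tensor C C;
  counit : C -> K;
  comul_is_linear : linear comul;
  counit_is_scalar : scalar counit;
  comulA : forall x,
    tassoc (tmap comul idfun (comul x)) = tmap idfun comul (comul x);
  counitl : forall x, tlift (fun a b => counit a *: b) (comul x) = x;
  counitr : forall x, tlift (fun a b => counit b *: a) (comul x) = x
}.

#[short(type="coalgType")]
HB.structure Definition Coalgebra (K : fieldType) :=
  {C of GRing.Lmodule K C & isCoalgebra K C}.

HB.instance Definition _ (K : fieldType) (C : coalgType K) :=
  GRing.isLinear.Build K C (tensor C C) _ comul comul_is_linear.
HB.instance Definition _ (K : fieldType) (C : coalgType K) :=
  GRing.isLinear.Build K C K _ counit counit_is_scalar.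

HB.mixin Record Coalgebra_isBialgebra (K : fieldType) B
    of GRing.Algebra K B & Coalgebra K B := {
  comul_is_monoid_morphism : monoid_morphism (comul : B -> tensor B B);
  counit_is_monoid_morphism : monoid_morphism (counit : B -> K)
}.

#[short(type="bialgType")]
HB.structure Definition Bialgebra (K : fieldType) :=
  {B of GRing.Algebra K B & Coalgebra K B & Coalgebra_isBialgebra K B}.

HB.mixin Record hasAntipode (K : fieldType) H of Bialgebra K H := {
  antipode : H -> H;
  antipode_is_linear : linear antipode;
  antipodel : forall x : H,
    tlift (fun a b => antipode a * b) (comul x) = counit x *: 1;
  antipoder : forall x : H,
    tlift (fun a b => a * antipode b) (comul x) = counit x *: 1
}.

#[short(type="hopfAlgType")]
HB.structure Definition HopfAlgebra (K : fieldType) :=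
  {H of Bialgebra K H & hasAntipode K H}.

(* The coalgebra A ⊗ B: Δ(a ⊗ b) = (a_1 ⊗ b_1) ⊗ (a_2 ⊗ b_2). *)
Section TensorCoalgebra.
Variables (K : fieldType) (A B : coalgType K).

Definition tensor_comul (z : tensor A B) : tensor (tensor A B) (tensor A B) :=
  tmid (tmap comul comul z).
Definition tensor_counit (z : tensor A B) : K :=
  tlift (W := K^o : lmodType K) (fun a b => counit a * counit b) z.

Lemma tensor_comul_linear : linear tensor_comul.
Proof. by move=> a x y; rewrite /tensor_comul !linearP. Qed.

Lemma tensor_counit_bilin :
  @bilinear_for K A B K^o *:%R *:%R (fun a b => counit a * counit b).
Proof.
split=> [v a u u'|u a v v'] /=.
- by rewrite linearP /= mulrDl -mulrA.
- by rewrite linearP /= mulrDr mulrCA.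
Qed.

Lemma tensor_counit_scalar : scalar tensor_counit.
Proof. exact: tlift_linear tensor_counit_bilin. Qed.

HB.instance Definition _ := GRing.isLinear.Build K (tensor A B)
  (tensor (tensor A B) (tensor A B)) _ tensor_comul tensor_comul_linear.
HB.instance Definition _ := GRing.isLinear.Build K (tensor A B)
  K _ tensor_counit tensor_counit_scalar.

Lemma tensor_comulE a b : tensor_comul (a ⊗ b) = tmid (comul a ⊗ comul b).
Proof. by rewrite /tensor_comul tmapE. Qed.
Lemma tensor_counitE a b : tensor_counit (a ⊗ b) = counit a * counit b.
Proof. exact: tlift_tens tensor_counit_bilin. Qed.

Definition tensor_interchange3 (s : tensor A (tensor A A))
    (t : tensor B (tensor B B)) :
    tensor (tensor A B) (tensor (tensor A B) (tensor A B)) :=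
  tmap idfun (@tmid K A A B B) (tmid (s ⊗ t)).

Lemma tensor_comulA_l s t :
  tassoc (tmap tensor_comul idfun (tmid (s ⊗ t))) =
  tensor_interchange3 (tassoc (tmap comul idfun s)) (tassoc (tmap comul idfun t)).
Proof.
rewrite /tensor_interchange3.
elim/tensorW: s => [a a'|x x' IH IH'];
  last by rewrite !(tensDl, linearD) /= IH IH'.
elim/tensorW: t => [b b'|x x' IH IH']; last first.
  by rewrite !(tensDr, linearD) /= IH IH'.
rewrite tmidE !tmapE /= tensor_comulE.
move: (comul a) (comul b) => s t.
elim/tensorW: s => [c c'|x x' IH IH'];
  last by rewrite !(tensDl, linearD) /= IH IH'.
elim/tensorW: t => [d d'|x x' IH IH']; last first.
  by rewrite !(tensDl, tensDr, linearD) /= IH IH'.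
by rewrite !tassocE !tmidE tassocE tmapE /= tmidE.
Qed.

Lemma tensor_comulA_r s t :
  tmap idfun tensor_comul (tmid (s ⊗ t)) =
  tensor_interchange3 (tmap idfun comul s) (tmap idfun comul t).
Proof.
rewrite /tensor_interchange3.
elim/tensorW: s => [a a'|x x' IH IH'];
  last by rewrite !(tensDl, linearD) /= IH IH'.
elim/tensorW: t => [b b'|x x' IH IH']; last first.
  by rewrite !(tensDr, linearD) /= IH IH'.
by rewrite tmidE !tmapE /= tensor_comulE tmidE tmapE.
Qed.

Lemma tensor_comulA x :
  tassoc (tmap tensor_comul idfun (tensor_comul x)) =
  tmap idfun tensor_comul (tensor_comul x).
Proof.
elim/tensorW: x => [a b|x x' IH IH']; last by rewrite !linearD /= IH IH'.
by rewrite tensor_comulE tensor_comulA_l tensor_comulA_r !comulA.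
Qed.

Lemma tensor_counitl x :
  tlift (fun a b => tensor_counit a *: b) (tensor_comul x) = x.
Proof.
rewrite -[LHS]/(tcontractl tensor_counit _).
elim/tensorW: x => [a b|x x' IH IH']; last by rewrite !linearD /= IH IH'.
rewrite tensor_comulE -[in RHS](counitl a) -[in RHS](counitl b).
rewrite -[tlift _ (comul a)]/(tcontractl counit _).
rewrite -[tlift _ (comul b)]/(tcontractl counit _).
elim/tensorW: (comul a) => [c c'|x x' IH IH'];
  last by rewrite !(tensDl, linearD) /= IH IH'.
elim/tensorW: (comul b) => [d d'|x x' IH IH'];
  last by rewrite !(tensDr, linearD) /= IH IH'.
by rewrite tmidE !tcontractlE /= tensor_counitE tensZl tensZr scalerA.
Qed.

Lemma tensor_counitr x :
  tlift (fun a b => tensor_counit b *: a) (tensor_comul x) = x.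
Proof.
rewrite -[LHS]/(tcontractr tensor_counit _).
elim/tensorW: x => [a b|x x' IH IH']; last by rewrite !linearD /= IH IH'.
rewrite tensor_comulE -[in RHS](counitr a) -[in RHS](counitr b).
rewrite -[tlift _ (comul a)]/(tcontractr counit _).
rewrite -[tlift _ (comul b)]/(tcontractr counit _).
elim/tensorW: (comul a) => [c c'|x x' IH IH'];
  last by rewrite !(tensDl, linearD) /= IH IH'.
elim/tensorW: (comul b) => [d d'|x x' IH IH'];
  last by rewrite !(tensDr, linearD) /= IH IH'.
by rewrite tmidE !tcontractrE /= tensor_counitE tensZl tensZr scalerA.
Qed.

HB.instance Definition _ := isCoalgebra.Build K (tensor A B)
  tensor_comul_linear tensor_counit_scalar tensor_comulA
  tensor_counitl tensor_counitr.

End TensorCoalgebra.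

Section TensorBialgebra.
Variables (K : fieldType) (A B : bialgType K).

Lemma tensor_oner_neq0 : (1 : tensor A B) != 0.
Proof.
apply/eqP => /(congr1 (@tensor_counit K A B)).
rewrite linear0 tens1 tensor_counitE !(counit_is_monoid_morphism.1) mulr1.
by move/eqP; rewrite oner_eq0.
Qed.

HB.instance Definition _ :=
  GRing.PzSemiRing_isNonZero.Build (tensor A B) tensor_oner_neq0.
HB.instance Definition _ :=
  GRing.Lmodule_isLalgebra.Build K (tensor A B) (@tensor_scalerAl K A B).
HB.instance Definition _ :=
  GRing.Lalgebra_isAlgebra.Build K (tensor A B) (@tensor_scalerAr K A B).

Lemma tmidM (s s' : tensor A A) (t t' : tensor B B) :
  tmid ((s * s') ⊗ (t * t')) = tmid (s ⊗ t) * tmid (s' ⊗ t').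
Proof.
elim/tensorW: s => [a1 a2|x y ex ey];
  last by rewrite mulrDl !(tensDl, linearD) /= mulrDl ex ey.
elim/tensorW: s' => [c1 c2|x y ex ey];
  last by rewrite mulrDr !(tensDl, linearD) /= mulrDr ex ey.
elim/tensorW: t => [b1 b2|x y ex ey];
  last by rewrite mulrDl !(tensDr, linearD) /= mulrDl ex ey.
elim/tensorW: t' => [d1 d2|x y ex ey];
  last by rewrite mulrDr !(tensDr, linearD) /= mulrDr ex ey.
by rewrite !tensM !tmidE !tensM.
Qed.

Lemma tensor_comul_monoid :
  monoid_morphism (comul : tensor A B -> tensor (tensor A B) (tensor A B)).
Proof.
split=> [|x y].
  rewrite {1}tens1 [LHS]tensor_comulE !(comul_is_monoid_morphism.1).
  by rewrite !tens1 tmidE.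
elim/tensorW: x => [a b|x x' IH IH']; 
  last by rewrite mulrDl !linearD /= IH IH' mulrDl.
elim/tensorW: y => [c d|x x' IH IH']; 
  last by rewrite mulrDr !linearD /= IH IH' mulrDr.
rewrite tensM ![comul (_ ⊗ _)]tensor_comulE !(comul_is_monoid_morphism.2).
exact: tmidM.
Qed.

Lemma tensor_counit_monoid : monoid_morphism (counit : tensor A B -> K).
Proof.
split=> [|x y].
  by rewrite tens1 [LHS]tensor_counitE !(counit_is_monoid_morphism.1) mulr1.
elim/tensorW: x => [a b|x x' IH IH']; 
  last by rewrite mulrDl !linearD /= IH IH' mulrDl.
elim/tensorW: y => [c d|x x' IH IH']; 
  last by rewrite mulrDr !linearD /= IH IH' mulrDr.
rewrite tensM ![counit (_ ⊗ _)]tensor_counitE !(counit_is_monoid_morphism.2).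
by rewrite mulrACA.
Qed.

HB.instance Definition _ := Coalgebra_isBialgebra.Build K (tensor A B)
  tensor_comul_monoid tensor_counit_monoid.

End TensorBialgebra.

(* B^op is MathComp's converse ring B^c: same vector space and coalgebra,
   opposite multiplication. *)
HB.instance Definition _ (K : fieldType) (V : lmodType K) := GRing.Lmodule.on V^c.
HB.instance Definition _ (K : fieldType) (C : coalgType K) := Coalgebra.on C^c.

Section OppositeBialgebra.
Variables (K : fieldType) (B : bialgType K).

Lemma opp_scalerAl (a : K) (x y : B^c) : a *: (x * y) = (a *: x : B^c) * y.
Proof. exact: (@scalerAr K B a y x). Qed.
HB.instance Definition _ := GRing.Lmodule_isLalgebra.Build K B^c opp_scalerAl.
Lemma opp_scalerAr (a : K) (x y : B^c) : a *: (x * y) = x * (a *: y : B^c).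
Proof. exact: (@scalerAl K B a y x). Qed.
HB.instance Definition _ := GRing.Lalgebra_isAlgebra.Build K B^c opp_scalerAr.

Lemma opp_tensorM (x y : tensor B B) :
  (x : tensor B^c B^c) * (y : tensor B^c B^c) = y * x.
Proof.
elim/tensorW: x => [a b|x x' IH IH'];
  last by rewrite [RHS]mulrDr -IH -IH'; exact: (@mulrDl (tensor B^c B^c)).
elim/tensorW: y => [c d|x x' IH IH'];
  last by rewrite [RHS]mulrDl -IH -IH'; exact: (@mulrDr (tensor B^c B^c)).
by rewrite [RHS]tensM; exact: (@tensM K B^c B^c a c b d).
Qed.

Lemma opp_comul_monoid : monoid_morphism (comul : B^c -> tensor B^c B^c).
Proof.
split=> [|x y]; first exact: (@comul_is_monoid_morphism K B).1.
rewrite opp_tensorM; exact: ((@comul_is_monoid_morphism K B).2 y x).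
Qed.
Lemma opp_counit_monoid : monoid_morphism (counit : B^c -> K).
Proof.
split=> [|x y]; first exact: (@counit_is_monoid_morphism K B).1.
by rewrite mulrC; exact: ((@counit_is_monoid_morphism K B).2 y x).
Qed.
HB.instance Definition _ := Coalgebra_isBialgebra.Build K B^c
  opp_comul_monoid opp_counit_monoid.
End OppositeBialgebra.

Lemma tens_oppM (K : fieldType) (B : bialgType K) (a b c d : B) :
  ((a ⊗ b : tensor B B^c) * (c ⊗ d : tensor B B^c) : tensor B B^c) =
  (a * c) ⊗ (d * b).
Proof. exact: (@tensM K B B^c a c b d). Qed.

Section CofreeHopf.
Variable K : fieldType.

Definition cocommutative (C : coalgType K) : Prop :=
  forall x : C, tswap (comul x) = comul x.

Definition is_bialg_map (A B : bialgType K) (f : A -> B) : Prop :=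
  [/\ linear f, monoid_morphism f,
      forall x, comul (f x) = tmap f f (comul x)
    & forall x, counit (f x) = counit x].

Definition is_hopf_map (H H' : hopfAlgType K) (f : H -> H') : Prop :=
  is_bialg_map f /\ forall x, f (antipode x) = antipode (f x).

(* C, via i, is the sub-bialgebra of A with underlying subset S. *)
Definition is_sub_bialgebra (A C : bialgType K) (i : C -> A) (S : A -> Prop) :
    Prop :=
  [/\ is_bialg_map i, injective i & forall z, S z <-> exists c, i c = z].

(* z = Σ x ⊗ y lies in (B ⊗ B)^co B:
   Σ (x_1 ⊗ y_1) ⊗ x_2 y_2 = Σ (x ⊗ y) ⊗ 1. *)
Definition coinvariant (B : bialgType K) (z : tensor B B) : Prop :=
  tmap idfun (@tmul K B) (comul z) = z ⊗ 1.

(* Σ x ⊗ y ↦ Σ x ε(y) *)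
Definition coinv_proj (B : bialgType K) : tensor B B -> B := tcontractr counit.

(* B ⊗ B^op and B ⊗ B have the same underlying type. *)
Definition cofree_set (B : bialgType K) (z : tensor B B^c) : Prop :=
  coinvariant (z : tensor B B) /\ coinvariant (tswap (z : tensor B B)).

Definition is_cofree_cocomm_hopf (B : bialgType K) (C : hopfAlgType K)
    (e : C -> B) : Prop :=
  [/\ cocommutative C, is_bialg_map e
    & forall H : hopfAlgType K, cocommutative H ->
      forall f : H -> B, is_bialg_map f ->
      exists! g : H -> C, is_hopf_map g /\ e \o g =1 f].

End CofreeHopf.

(* Main.v *)
From HB Require Import structures.
Require Import Defs.
From mathcomp Require Import all_boot all_algebra.
From mathcomp Require Import boolp classical_sets.

(** Write A for the cocommutative bialgebra B ⊗ B^op, m and m' for the linear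
    maps A → B sending x ⊗ y to x y and to y x, and C for the subspace of the
    theorem.  As the swap of the two factors is a coalgebra map, C consists of
    the z in A such that z1 ⊗ m(z2) = z ⊗ 1 and z1 ⊗ m'(z2) = z ⊗ 1
    ([cofree_setE]).  The intuition is that y is an inverse of x, on both
    sides.

    C is a Hopf algebra.  It is a subalgebra because m(c d) = x m(d) y for
    c = x ⊗ y, and symmetrically for m' ([cofree_setM]).  It is a subcoalgebra
    because both conditions are linear equations f(z) = 0 such that
    f(z) = 0 implies (id ⊗ f)(Δ z) = 0 ([coinv_defect_comul]); over a field
    this puts Δ z in A ⊗ C, and by cocommutativity in C ⊗ C.  That last step is
    carried out with a linear projection of A onto C, which Zorn's lemma
    provides ([pseudo_inverse], [kernel_projection]).  The antipode is the swap
    S: cocommutativity of B gives S(z1) z2 = m'(z1) ⊗ m'(z2), and m'(z) = ε(z)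
    on C, so this is ε(z); the other axiom is the same with m
    ([pswap_conv_pmulop], [pswap_conv_pmul]).

    C is cofree.  For H cocommutative and f : H → B, the required map sends h
    to f(h1) ⊗ f(S h2).  It is a bialgebra map because S reverses products and,
    H being cocommutative, both S and the coproduct of H are coalgebra maps;
    its values lie in C by the antipode axioms.  It is the only one, because
    every z in A equals p(z1) ⊗ p(S z2), where p(x ⊗ y) = x ε(y)
    ([tensor_recover]), and a map of Hopf algebras commutes with
    antipodes.  The main facts about antipodes are instances of the
    uniqueness of inverses in convolution algebras ([conv_inv_uniq]). *)

Set Implicit Arguments.
Unset Strict Implicit.
Unset Printing Implicit Defensive.

Import GRing.Theory.
Local Open Scope ring_scope.

(** * Linear pseudo-inverses *)

(** Bundling as an explicit function, for linear maps met inside proofs whose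
    linearity is only a local hypothesis. *)
Definition linear_of (K : fieldType) (U V : lmodType K) (f : U -> V)
    (fL : linear f) : {linear U -> V} :=
  HB.pack_for {linear U -> V} f (GRing.isLinear.Build K U V _ f fL).

Section PseudoInverse.
Local Open Scope classical_set_scope.
Variable K : fieldType.

Definition subspace (V : lmodType K) (C : V -> Prop) : Prop :=
  C 0 /\ forall (a : K) u v, C u -> C v -> C (a *: u + v).

Lemma subspaceB (V : lmodType K) (C : V -> Prop) u v :
  subspace C -> C u -> C v -> C (u - v).
Proof. by case=> _ CP Cu Cv; rewrite addrC -scaleN1r; apply: CP. Qed.

(** Zorn: a maximal set D, closed under linear combinations and meeting C only
    in 0, must satisfy C + D = V, since a vector z outside the sum could be
    adjoined to D. *)
Lemma subspace_complement (V : lmodType K) (C : V -> Prop) : subspace C ->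
  exists D : V -> Prop, [/\ subspace D, forall v, C v -> D v -> v = 0
    & forall v, exists2 d, D d & C (v - d)].
Proof.
move=> subC; have [C0 CP] := subC.
pose P (X : set V) := (forall (a : K) u v, X u -> X v -> X (a *: u + v)) /\
  forall v, C v -> X v -> v = 0.
have [F sFP chF|X [[XP XC] Xmax]] := @Zorn_bigcup V P.
  split=> [a u v [Y FY Yu] [Z FZ Zv]|v Cv [Y FY Yv]].
    have [YZ|ZY] := chF _ _ FY FZ.
      by exists Z => //; apply: (sFP _ FZ).1 => //; apply: YZ.
    by exists Y => //; apply: (sFP _ FY).1 => //; apply: ZY.
  exact: (sFP _ FY).2 Cv Yv.
(* The empty set is admissible in the Zorn argument, so 0 is added by hand. *)
pose D v := v = 0 \/ X v.
have subD : subspace D.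
  split=> [|a u v]; first by left.
  case=> [->|Xu] [->|Xv].
  - by left; rewrite scaler0 addr0.
  - by right; rewrite scaler0 add0r.
  - right; have X0 : X 0 by rewrite -(addNr u) -scaleN1r; apply: XP.
    exact: XP.
  - by right; apply: XP.
have DC v : C v -> D v -> v = 0 by move=> Cv [//|]; apply: XC.
exists D; split=> // z; apply: contrapT => nz.
pose Y v := exists a x, D x /\ v = a *: z + x.
have zY : Y z by exists 1, 0; split; [left|rewrite scale1r addr0].
have XY : X `<=` Y.
  by move=> x Xx; exists 0, x; split; [right|rewrite scale0r add0r].
apply: (Xmax Y); first last.
  split=> [a _ _ [b [x [Dx ->]]] [c [y [Dy ->]]]|v Cv [a [x [Dx vE]]]].
    exists (a * b + c), (a *: x + y); split; first exact: subD.2.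
    by rewrite scalerDr scalerA scalerDl addrACA.
  rewrite vE in Cv *; move: Cv; have [->|a0] := eqVneq a 0.
    by rewrite scale0r add0r => Cx; apply: DC.
  move=> Cv; case: nz; exists (- a^-1 *: x).
    by rewrite -[_ *: x]addr0; apply: subD.2 => //; left.
  rewrite scaleNr opprK -[z]scale1r -(mulVf a0) -scalerA -scalerDr.
  by rewrite -[_ *: _]addr0; apply: CP.
split=> // YX; case: nz; exists z; last by rewrite subrr.
by right; apply: YX.
Qed.

(** Split U = ker f + D and W = im f + E; then g sends w to the unique d in D
    such that w - f d lies in E.  Tensoring the equation f g f = f with another
    space keeps it true, so that pseudo-inverses stand in for the exactness of
    the tensor product, with no choice of bases. *)
Lemma pseudo_inverse (U W : lmodType K) (f : {linear U -> W}) :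
  exists g : {linear W -> U}, forall u, f (g (f u)) = f u.
Proof.
have [|D [subD kerD sumD]] := @subspace_complement U (fun u => f u = 0).
  by split=> [|a u v fu fv]; rewrite ?linear0 // linearP fu fv scaler0 addr0.
have [|E [subE imE sumE]] := @subspace_complement W (fun w => exists u, f u = w).
  split=> [|a _ _ [u <-] [v <-]]; first by exists 0; rewrite linear0.
  by exists (a *: u + v); rewrite linearP.
have [w|g gP] := @choice W U (fun w u => D u /\ E (w - f u)).
  have [e Ee [u fu]] := sumE w; have [d Dd fud] := sumD u.
  exists d; split=> //; move/eqP: fud; rewrite linearB subr_eq0 => /eqP <-.
  by rewrite fu subKr.
have g_uniq w u : D u -> E (w - f u) -> u = g w.
  have [Dg Eg] := gP w; move=> Du Eu; apply/eqP; rewrite -subr_eq0; apply/eqP.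
  apply: kerD; last exact: subspaceB.
  apply: imE; first by exists (u - g w).
  have -> : f (u - g w) = (w - f (g w)) - (w - f u).
    by rewrite linearB [RHS]addrC opprB addrA subrK.
  exact: subspaceB.
have g_lin : linear g.
  move=> a v w; apply/esym/g_uniq; have [Dv Ev] := gP v; have [Dw Ew] := gP w.
    exact: subD.2.
  by rewrite linearP opprD addrACA -scalerBr; apply: subE.2.
exists (linear_of g_lin) => u /=.
apply/esym/eqP; rewrite -subr_eq0; apply/eqP; apply: imE; last exact: (gP _).2.
by exists (u - g (f u)); rewrite linearB.
Qed.
End PseudoInverse.

(** * Naturality of the tensor constructions *)

Section TensorFunctoriality.
Variable K : fieldType.
Implicit Types U V W : lmodType K.

Lemma tmap_comp U U' U'' V V' V'' (f : {linear U' -> U''}) (f' : {linear U -> U'})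
    (g : {linear V' -> V''}) (g' : {linear V -> V'}) z :
  tmap f g (tmap f' g' z) = tmap (f \o f') (g \o g') z.
Proof.
elim/tensorW: z => [u v|x y ex ey]; first by rewrite !tmapE.
by rewrite !linearD /= ex ey.
Qed.

Lemma tmap_id U V (z : tensor U V) : tmap idfun idfun z = z.
Proof.
elim/tensorW: z => [u v|x y ex ey]; first by rewrite tmapE.
by rewrite linearD /= ex ey.
Qed.

Lemma tmapK U U' V V' (f : {linear U -> U'}) (f' : {linear U' -> U})
    (g : {linear V -> V'}) (g' : {linear V' -> V}) :
  cancel f f' -> cancel g g' -> cancel (tmap f g) (tmap f' g').
Proof.
move=> fK gK z; elim/tensorW: z => [u v|x y ex ey].
  by rewrite !tmapE fK gK.
by rewrite !linearD /= ex ey.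
Qed.

Lemma tswapK U V : cancel (@tswap K U V) (@tswap K V U).
Proof.
move=> z; elim/tensorW: z => [u v|x y ex ey]; first by rewrite !tswapE.
by rewrite !linearD /= ex ey.
Qed.

Lemma tswap_tmap U U' V V' (f : {linear U -> U'}) (g : {linear V -> V'}) z :
  tswap (tmap f g z) = tmap g f (tswap z).
Proof.
elim/tensorW: z => [u v|x y ex ey]; first by rewrite tmapE !tswapE tmapE.
by rewrite !linearD /= ex ey.
Qed.

Lemma tassoc_tmap U U' V V' W W' (f : {linear U -> U'}) (g : {linear V -> V'})
    (h : {linear W -> W'}) z :
  tassoc (tmap (tmap f g) h z) = tmap f (tmap g h) (tassoc z).
Proof.
elim/tensorW: z => [t w|x y ex ey]; last by rewrite !linearD /= ex ey.
elim/tensorW: t => [u v|x y ex ey]; first by rewrite tassocE !tmapE /= !tmapE tassocE.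
by rewrite tensDl !linearD /= ex ey.
Qed.

(** Five alternating swaps and reassociations compose to the inverse of
    [tassoc], so that its linearity comes for free. *)
Definition tassocV U V W : tensor U (tensor V W) -> tensor (tensor U V) W :=
  @tswap K _ _ \o @tassoc K _ _ _ \o @tswap K _ _ \o @tassoc K _ _ _
    \o @tswap K _ _.
HB.instance Definition _ U V W := GRing.Linear.on (@tassocV U V W).

Lemma tassocVE U V W (u : U) (v : V) (w : W) :
  tassocV (u ⊗ (v ⊗ w)) = u ⊗ v ⊗ w.
Proof. by rewrite /tassocV /= !(tswapE, tassocE). Qed.

Lemma tassocK U V W : cancel (@tassoc K U V W) (@tassocV U V W).
Proof.
move=> z; elim/tensorW: z => [t w|x y ex ey]; last by rewrite !linearD /= ex ey.
elim/tensorW: t => [u v|x y ex ey]; first by rewrite tassocE tassocVE.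
by rewrite tensDl !linearD /= ex ey.
Qed.

Lemma tassocV_tmap U U' V V' W W' (f : {linear U -> U'})
    (g : {linear V -> V'}) (h : {linear W -> W'}) z :
  tassocV (tmap f (tmap g h) z) = tmap (tmap f g) h (tassocV z).
Proof.
elim/tensorW: z => [u t|x y ex ey]; last by rewrite !linearD /= ex ey.
elim/tensorW: t => [v w|x y ex ey]; first by rewrite tassocVE !tmapE /= !tmapE tassocVE.
by rewrite tensDr !linearD /= ex ey.
Qed.

(** The interchange of the two middle factors is conjugate to a swap; this is
    the form in which cocommutativity can be applied to it. *)
Lemma tmid_tassoc U V V' W (z : tensor U (tensor (tensor V V') W)) :
  tmid (tassocV (tmap idfun (@tassoc K V V' W) z)) =
  tassocV (tmap idfun (@tassoc K V' V W) (tmap idfun (tmap (@tswap K V V') idfun) z)).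
Proof.
elim/tensorW: z => [u t|x y ex ey]; last by rewrite !linearD /= ex ey.
elim/tensorW: t => [s w|x y ex ey]; last by rewrite tensDr !linearD /= ex ey.
elim/tensorW: s => [v v'|x y ex ey]; last first.
  by rewrite tensDl tensDr !linearD /= ex ey.
by rewrite !tmapE /= !tmapE /= tswapE !tassocE !tassocVE tmidE.
Qed.

Lemma tmid_tmap (A A' B B' C C' D D' : lmodType K) (a : {linear A -> A'})
    (b : {linear B -> B'}) (c : {linear C -> C'}) (d : {linear D -> D'}) z :
  tmid (tmap (tmap a b) (tmap c d) z) = tmap (tmap a c) (tmap b d) (tmid z).
Proof.
elim/tensorW: z => [s t|x y ex ey]; last by rewrite !linearD /= ex ey.
elim/tensorW: s => [s1 s2|x y ex ey]; last by rewrite tensDl !linearD /= ex ey.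
elim/tensorW: t => [t1 t2|x y ex ey]; last by rewrite tensDr !linearD /= ex ey.
by rewrite tmidE !tmapE /= !tmapE tmidE.
Qed.

End TensorFunctoriality.

Section CoalgebraMaps.
Variable K : fieldType.
Implicit Types C D E : coalgType K.

Definition coalg_map C D (f : C -> D) : Prop :=
  (forall x, comul (f x) = tmap f f (comul x)) /\
  (forall x, counit (f x) = counit x).

Lemma coalg_map_comp C D E (f : {linear D -> E}) (g : {linear C -> D}) :
  coalg_map f -> coalg_map g -> coalg_map (f \o g).
Proof.
move=> [fC fe] [gC ge]; split=> x /=; last by rewrite fe ge.
by rewrite fC gC tmap_comp.
Qed.

Lemma coalg_map_tmap C C' D D' (f : {linear C -> C'}) (g : {linear D -> D'}) :
  coalg_map f -> coalg_map g -> coalg_map (tmap f g).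
Proof.
move=> [fC fe] [gC ge]; split=> z.
  rewrite -[comul (tmap _ _ _)]/(tmid (tmap comul comul _)).
  rewrite -[comul z]/(tmid (tmap comul comul z)) -tmid_tmap !tmap_comp.
  congr tmid; elim/tensorW: z => [u v|x y ex ey].
    by rewrite !tmapE /= fC gC.
  by rewrite !linearD /= ex ey.
elim/tensorW: z => [u v|x y ex ey]; last by rewrite !linearD /= ex ey.
by rewrite tmapE [LHS]tensor_counitE [RHS]tensor_counitE fe ge.
Qed.

(** In Sweedler notation the two sides are x1 ⊗ x3 ⊗ x2 ⊗ x4 and
    x1 ⊗ x2 ⊗ x3 ⊗ x4.  Reading the fourfold coproduct as
    x1 ⊗ (Δ x2 ⊗ x3) puts both middle factors in a single coproduct, which
    cocommutativity leaves fixed under the swap. *)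
Lemma comul_coalg_map C : cocommutative C -> coalg_map (comul : C -> tensor C C).
Proof.
move=> coC; split=> x; last first.
  rewrite -[in RHS](counitl x) -[tlift _ _]/(tcontractl counit _).
  elim/tensorW: (comul x) => [u v|y z ey ez]; last by rewrite !linearD /= ey ez.
  by rewrite [LHS]tensor_counitE tcontractlE linearZ.
rewrite -[LHS]/(tmid (tmap comul comul (comul x))).
have -> : tmap comul comul (comul x) = tassocV (tmap idfun (@tassoc K C C C)
    (tmap idfun (tmap comul idfun) (tmap idfun comul (comul x)))).
  have -> : tmap comul comul (comul x) =
      tmap (tmap idfun idfun) comul (tmap comul idfun (comul x)).
    rewrite tmap_comp; elim/tensorW: (comul x) => [u v|y z ey ez].
      by rewrite !tmapE /= tmap_id.
    by rewrite !linearD /= ey ez.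
  rewrite -[tmap comul idfun _]tassocK comulA -tassocV_tmap; congr tassocV.
  rewrite !tmap_comp; elim/tensorW: (comul x) => [u v|y z ey ez].
    by rewrite !tmapE /= comulA.
  by rewrite !linearD /= ey ez.
rewrite tmid_tassoc; congr tassocV; congr tmap.
rewrite !tmap_comp; elim/tensorW: (comul x) => [u v|y z ey ez].
  rewrite !tmapE /=; congr (_ ⊗ _); elim/tensorW: (comul v) => [w w'|y z ey ez].
    by rewrite !tmapE /= coC.
  by rewrite !linearD /= ey ez.
by rewrite !linearD /= ey ez.
Qed.

End CoalgebraMaps.

(** * Convolution *)

Lemma eq_tmap (K : fieldType) (U U' V V' : lmodType K) (f f' : U -> U')
    (g g' : V -> V') z : f =1 f' -> g =1 g' -> tmap f g z = tmap f' g' z.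
Proof. by move=> ef eg; apply: eq_bigr => p _; rewrite ef eg. Qed.

Section Convolution.
Variable K : fieldType.
Implicit Types (C D : coalgType K) (A : algType K).

Definition conv C A (f g : C -> A) : C -> A := @tmul K A \o tmap f g \o comul.
HB.instance Definition _ C A (f g : {linear C -> A}) :=
  GRing.Linear.on (conv f g).

Definition conv_unit C A : C -> A := *:%R^~ 1 \o counit.
Lemma conv_unit_linear C A : linear (@conv_unit C A).
Proof. by move=> a x y; rewrite /conv_unit /= linearP scalerDl scalerA. Qed.
HB.instance Definition _ C A :=
  GRing.isLinear.Build K C A _ (@conv_unit C A) (@conv_unit_linear C A).

Lemma eq_conv C A (f f' g g' : C -> A) :
  f =1 f' -> g =1 g' -> conv f g =1 conv f' g'.
Proof. by move=> ef eg x; congr tmul; apply: eq_tmap. Qed.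

Lemma conv1l C A (f : {linear C -> A}) : conv (@conv_unit C A) f =1 f.
Proof.
move=> x; rewrite -[in RHS](counitl x) -[tlift _ _]/(tcontractl counit _) /conv /=.
elim/tensorW: (comul x) => [u v|y z ey ez]; last by rewrite !linearD /= ey ez.
by rewrite tmapE tcontractlE /= tmulE -scalerAl mul1r linearZ.
Qed.

Lemma conv1r C A (f : {linear C -> A}) : conv f (@conv_unit C A) =1 f.
Proof.
move=> x; rewrite -[in RHS](counitr x) -[tlift _ _]/(tcontractr counit _) /conv /=.
elim/tensorW: (comul x) => [u v|y z ey ez]; last by rewrite !linearD /= ey ez.
by rewrite tmapE tcontractrE /= tmulE -scalerAr mulr1 linearZ.
Qed.

Lemma convA C A (f g h : {linear C -> A}) :
  conv (conv f g) h =1 conv f (conv g h).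
Proof.
have tmulA (t : tensor (tensor C C) C) :
    tmul (tmap (@tmul K A \o tmap f g) h t) =
    tmul (tmap f (@tmul K A \o tmap g h) (tassoc t)).
  elim/tensorW: t => [s w|x y ex ey]; last by rewrite !linearD /= ex ey.
  elim/tensorW: s => [u v|x y ex ey]; last by rewrite !(tensDl, linearD) /= ex ey.
  by rewrite tassocE !tmapE /= !tmapE /= !tmulE mulrA.
move=> x; transitivity
    (tmul (tmap (@tmul K A \o tmap f g) h (tmap comul idfun (comul x)))).
  by rewrite tmap_comp.
by rewrite tmulA comulA tmap_comp.
Qed.

(** A left and a right inverse in a monoid agree.  [antipodeM],
    [cocomm_antipode_coalg_map] and [bialg_map_antipode] each exhibit two
    inverses of one map. *)
Lemma conv_inv_uniq C A (l f r : {linear C -> A}) :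
  conv l f =1 @conv_unit C A -> conv f r =1 @conv_unit C A -> l =1 r.
Proof.
move=> lf fr x; rewrite -[LHS]conv1r -[RHS]conv1l.
rewrite -(eq_conv (frefl l) fr) -(eq_conv lf (frefl r)).
by rewrite convA.
Qed.

Lemma conv_coalg_map C D A (f g : {linear D -> A}) (h : {linear C -> D}) :
  coalg_map h -> conv (f \o h) (g \o h) =1 conv f g \o h.
Proof. by case=> hC _ x; rewrite /conv /= hC tmap_comp. Qed.

Lemma conv_alg_map C (A A' : algType K) (f g : {linear C -> A}) (h : {linear A -> A'}) :
  {morph h : a b / a * b} -> conv (h \o f) (h \o g) =1 h \o conv f g.
Proof.
move=> hM x; rewrite /conv /=.
elim/tensorW: (comul x) => [u v|y z ey ez]; last by rewrite !linearD /= ey ez.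
by rewrite !tmapE /= !tmulE hM.
Qed.

Lemma conv_unit_coalg_map C D A (h : C -> D) :
  coalg_map h -> @conv_unit D A \o h =1 @conv_unit C A.
Proof. by case=> _ he x; rewrite /conv_unit /= he. Qed.

Lemma conv_unit_alg_map C (A A' : algType K) (h : {linear A -> A'}) :
  h 1 = 1 -> h \o @conv_unit C A =1 @conv_unit C A'.
Proof. by move=> h1 x; rewrite /conv_unit /= linearZ /= h1. Qed.

Lemma tmul_swap_conv C A (f g : {linear C -> A}) : cocommutative C ->
  forall x, tmul (tswap (tmap f g (comul x))) = conv g f x.
Proof. by move=> coC x; rewrite tswap_tmap coC. Qed.

End Convolution.

Section AlgebraMaps.
Variable K : fieldType.

Lemma tmap_mul (A A' B B' : algType K) (f : {linear A -> A'}) (g : {linear B -> B'}) :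
  {morph f : a b / a * b} -> {morph g : a b / a * b} ->
  {morph tmap f g : s t / s * t}.
Proof.
move=> fM gM s t.
elim/tensorW: s => [a b|x y ex ey]; last by rewrite mulrDl !linearD /= mulrDl ex ey.
elim/tensorW: t => [c d|x y ex ey]; last by rewrite mulrDr !linearD /= mulrDr ex ey.
by rewrite tensM !tmapE tensM fM gM.
Qed.

Lemma conv_tensor (C C' : coalgType K) (A A' : bialgType K)
    (f g : {linear C -> A}) (f' g' : {linear C' -> A'}) :
  conv (tmap f f') (tmap g g') =1 tmap (conv f g) (conv f' g').
Proof.
have mulE s t : tmul (tmap (tmap f f') (tmap g g') (tmid (s ⊗ t))) =
    tmul (tmap f g s) ⊗ tmul (tmap f' g' t).
  elim/tensorW: s => [u v|a b ea eb]; last first.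
    by rewrite tensDl !linearD /= tensDl ea eb.
  elim/tensorW: t => [u' v'|a b ea eb]; last first.
    by rewrite tensDr !linearD /= ea eb.
  by rewrite tmidE !tmapE /= !tmapE !tmulE [LHS]tensM.
move=> z; elim/tensorW: z => [x y|x y ex ey]; last by rewrite !linearD /= ex ey.
rewrite tmapE -mulE.
by rewrite -[LHS]/(tmul (tmap _ _ (tmid (tmap comul comul (x ⊗ y))))) tmapE.
Qed.

End AlgebraMaps.

(** * Antipodes *)

(** Turns the element-wise formulation of the antipode axioms into a
    statement on convolutions. *)
Lemma tlift_mul (K : fieldType) (U V : lmodType K) (A : algType K)
    (f : {linear U -> A}) (g : {linear V -> A}) z :
  tlift (fun u v => f u * g v) z = tmul (tmap f g z).
Proof.
have fgB : bilin (fun u v => f u * g v).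
  split=> [v a u u'|u a v v'] /=.
    by rewrite linearP mulrDl scalerAl.
  by rewrite linearP mulrDr scalerAr.
apply: (tlift_unique (f := linear_of (tlift_linear fgB))
  (g := @tmul K A \o tmap f g)) => u v /=.
by rewrite tlift_tens // tmapE tmulE.
Qed.

Section Multiplications.
Variables (K : fieldType) (A : algType K) (a : A).

Lemma mul_right_linear : linear (fun x : A => x * a).
Proof. by move=> e x y; rewrite mulrDl scalerAl. Qed.
Lemma mul_left_linear : linear (fun x : A => a * x).
Proof. by move=> e x y; rewrite mulrDr scalerAr. Qed.

Definition mul_right (x : A) : A := x * a.
Definition mul_left (x : A) : A := a * x.
HB.instance Definition _ := GRing.isLinear.Build K A A _ mul_right mul_right_linear.
HB.instance Definition _ := GRing.isLinear.Build K A A _ mul_left mul_left_linear.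
End Multiplications.

Section Bialgebras.
Variables (K : fieldType) (B : bialgType K).

Lemma comul1 : comul (1 : B) = 1 ⊗ 1.
Proof. exact: (@comul_is_monoid_morphism K B).1. Qed.

Lemma comulM (x y : B) : comul (x * y) = comul x * comul y.
Proof. exact: (@comul_is_monoid_morphism K B).2. Qed.

Lemma counit1 : counit (1 : B) = 1.
Proof. exact: (@counit_is_monoid_morphism K B).1. Qed.

Lemma counitM (x y : B) : counit (x * y) = counit x * counit y.
Proof. exact: (@counit_is_monoid_morphism K B).2. Qed.

Lemma tmul_coalg_map : coalg_map (@tmul K B).
Proof.
split=> z.
  elim/tensorW: z => [x y|x y ex ey]; last by rewrite !linearD /= ex ey.
  rewrite tmulE comulM.
  by rewrite -[comul (x ⊗ y)]/(tmid (tmap comul comul (x ⊗ y))) tmapE.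
elim/tensorW: z => [x y|x y ex ey]; last by rewrite !linearD /= ex ey.
by rewrite tmulE counitM [RHS]tensor_counitE.
Qed.

End Bialgebras.

Section Antipode.
Variables (K : fieldType) (H : hopfAlgType K).
HB.instance Definition _ :=
  GRing.isLinear.Build K H H _ (@antipode K H) antipode_is_linear.

Lemma conv_antipodel : conv antipode idfun =1 @conv_unit K H H.
Proof.
move=> x; rewrite [RHS]/= -[RHS]antipodel.
exact: esym (tlift_mul (@antipode K H) idfun _).
Qed.

Lemma conv_antipoder : conv idfun antipode =1 @conv_unit K H H.
Proof.
move=> x; rewrite [RHS]/= -[RHS]antipoder.
exact: esym (tlift_mul idfun (@antipode K H) _).
Qed.

Lemma antipode1 : antipode (1 : H) = 1.
Proof.
have := conv_antipodel 1.
by rewrite /conv /conv_unit /= comul1 tmapE /= tmulE mulr1 counit1 scale1r.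
Qed.

Lemma counit_antipode (x : H) : counit (antipode x) = counit x.
Proof.
have := congr1 counit (conv_antipodel x).
rewrite /conv_unit /= linearZ /= counit1 mulr1 => <-.
rewrite -[in LHS](counitr x) -[tlift _ _]/(tcontractr counit _) /conv /=.
elim/tensorW: (comul x) => [u v|a b ea eb]; last by rewrite !linearD /= ea eb.
by rewrite tmapE tcontractrE tmulE counitM !linearZ /= mulrC.
Qed.

(** In the convolution algebra of H ⊗ H with values in H, both sides are
    inverse to the multiplication.  The left one is so because multiplication
    is a coalgebra map; for the right one,
    h1 k1 S(k2) S(h2) = h1 ε(k) S(h2) = ε(h) ε(k). *)
Lemma antipodeM (x y : H) : antipode (x * y) = antipode y * antipode x.
Proof.
pose r : {linear tensor H H -> H} :=
  @tmul K H \o tmap antipode antipode \o @tswap K H H.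
suff e : antipode \o @tmul K H =1 r.
  by have := e (x ⊗ y); rewrite /r /= tmulE tswapE tmapE tmulE.
apply: (@conv_inv_uniq K _ _ (antipode \o @tmul K H) (@tmul K H) r).
  move=> z; rewrite -(conv_unit_coalg_map _ (tmul_coalg_map H)) /=.
  rewrite -(conv_antipodel (tmul z)).
  exact: (conv_coalg_map antipode idfun (tmul_coalg_map H) z).
have rE s t : tmul (tmap (@tmul K H) r (tmid (s ⊗ t))) =
    tmul (tmap (mul_right (tmul (tmap idfun antipode t))) antipode s).
  elim/tensorW: s => [a b|u v eu ev]; last first.
    by rewrite tensDl !linearD /= eu ev.
  rewrite tmapE tmulE /= /mul_right.
  elim/tensorW: t => [c d|u v eu ev].
    by rewrite tmidE !tmapE /r /= !tmulE tswapE tmapE tmulE !mulrA.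
  by rewrite tensDr !linearD /= eu ev mulrDr mulrDl.
move=> z; elim/tensorW: z => [u v|a b ea eb]; last by rewrite !linearD /= ea eb.
rewrite -[LHS]/(tmul (tmap (@tmul K H) r (tmid (tmap comul comul (u ⊗ v))))) tmapE.
rewrite rE -[X in mul_right X]/(conv idfun antipode v) conv_antipoder.
rewrite /conv_unit /= [counit (u ⊗ v)]tensor_counitE.
rewrite mulrC -scalerA -[counit u *: 1]conv_antipoder.
have scaleE (f : {linear H -> H}) c t : (forall a, f a = c *: a) ->
    tmul (tmap f antipode t) = c *: tmul (tmap idfun antipode t).
  move=> fE; elim/tensorW: t => [a b|a b ea eb]; last by rewrite !linearD /= ea eb.
  by rewrite !tmapE !tmulE fE -scalerAl.
apply: (scaleE (mul_right (counit v *: 1))) => a.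
by rewrite /= /mul_right -scalerAr mulr1.
Qed.

(** In the convolution algebra of H with values in H ⊗ H, both Δ S and
    (S ⊗ S) Δ are inverse to Δ: the first because Δ is an algebra map, the
    second because Δ is a coalgebra map, H being cocommutative, and because
    S ⊗ S is the antipode of H ⊗ H. *)
Lemma cocomm_antipode_coalg_map : cocommutative H -> coalg_map (@antipode K H).
Proof.
move=> coH; split; last exact: counit_antipode.
pose r : {linear H -> tensor H H} := tmap antipode antipode \o comul.
apply: (@conv_inv_uniq K _ _ (comul \o @antipode K H) comul r) => x.
  rewrite (conv_alg_map antipode idfun (@comulM _ _)) /= conv_antipodel.
  by rewrite /conv_unit /= linearZ /= comul1.
have -> : conv comul r x = conv idfun (tmap antipode antipode) (comul x).
  exact: (conv_coalg_map idfun (tmap antipode antipode) (comul_coalg_map coH) x).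
rewrite -(conv_unit_coalg_map _ (comul_coalg_map coH)) /=.
move: (comul x) => z; transitivity (tmap (conv idfun antipode) (conv idfun antipode) z).
  rewrite -conv_tensor; apply: eq_conv => // t; exact/esym/tmap_id.
elim/tensorW: z => [u v|a b ea eb]; last by rewrite !linearD /= ea eb.
rewrite tmapE /= !conv_antipoder /conv_unit /= [counit (u ⊗ v)]tensor_counitE.
by rewrite tensZl tensZr scalerA.
Qed.

End Antipode.

(** Both composites are convolution inverses of f. *)
Lemma bialg_map_antipode (K : fieldType) (H H' : hopfAlgType K) (f : {linear H -> H'}) :
  monoid_morphism f -> coalg_map f -> forall x, f (antipode x) = antipode (f x).
Proof.
move=> [f1 fM] fC.
apply: (@conv_inv_uniq K _ _ (f \o antipode) f (antipode \o f)) => x.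
  rewrite (conv_alg_map antipode idfun fM) /= conv_antipodel.
  exact: (conv_unit_alg_map f1).
rewrite -(conv_unit_coalg_map _ fC) /= -conv_antipoder.
exact: (conv_coalg_map idfun antipode fC x).
Qed.

(** * Coinvariants of a linear map out of a coalgebra *)

Lemma tmap_compr (K : fieldType) (V U U' U'' : lmodType K)
    (f : {linear U' -> U''}) (g : {linear U -> U'}) (z : tensor V U) :
  tmap idfun (f \o g) z = tmap idfun f (tmap idfun g z).
Proof. exact/esym/tmap_comp. Qed.

Lemma tmap_combr (K : fieldType) (V V' U' W' : lmodType K)
    (h : {linear V -> V'}) (f g k : {linear U' -> W'}) a t :
  (forall u, k u = a *: f u + g u) -> tmap h k t = a *: tmap h f t + tmap h g t.
Proof.
move=> kE; elim/tensorW: t => [v u|x y ex ey].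
  by rewrite !tmapE kE tensDr tensZr.
by rewrite !linearD /= ex ey addrACA.
Qed.

Section KernelProjection.
Variables (K : fieldType) (U W1 W2 : lmodType K).
Variables (f1 : {linear U -> W1}) (f2 : {linear U -> W2}).

(** With g a pseudo-inverse of f = (f1, f2), the map id - g f projects onto
    ker f1 ∩ ker f2.  The last clause is the inclusion of
    ker (id ⊗ f1) ∩ ker (id ⊗ f2) in V ⊗ (ker f1 ∩ ker f2). *)
Lemma kernel_projection : exists p : {linear U -> U},
  [/\ forall u, f1 (p u) = 0 /\ f2 (p u) = 0,
      forall u, f1 u = 0 -> f2 u = 0 -> p u = u
    & forall (V : lmodType K) (t : tensor V U), tmap idfun f1 t = 0 ->
      tmap idfun f2 t = 0 -> tmap idfun p t = t].
Proof.
have fL : linear (fun u => (f1 u, f2 u)).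
  by move=> a u v; rewrite !linearP.
have i1L : linear (fun w : W1 => (w, 0 : W2)).
  by move=> a u v; apply: injective_projections; rewrite /= ?scaler0 ?addr0.
have i2L : linear (fun w : W2 => (0 : W1, w)).
  by move=> a u v; apply: injective_projections; rewrite /= ?scaler0 ?addr0.
pose f := linear_of fL.
have [g fgf] := pseudo_inverse f.
have pL : linear (fun u => u - g (f u)).
  by move=> a u v; rewrite (linearP f) (linearP g) /= opprD addrACA -scalerBr.
exists (linear_of pL); split=> [u|u u1 u2|V t t1 t2].
- have : f (u - g (f u)) = 0 by rewrite (linearB f) fgf subrr.
  by case.
- have fu : f u = 0 by rewrite /f /= u1 u2.
  by rewrite -[LHS]/(u - g (f u)) fu linear0 subr0.
have ft : tmap idfun f t = 0.
  rewrite (@tmap_combr _ _ _ _ _ _ (linear_of i1L \o f1) (linear_of i2L \o f2) f 1).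
    rewrite !tmap_compr t1 t2 !linear0 addr0 //.
  by move=> u; rewrite scale1r /= /f /=; congr (_, _); rewrite ?addr0 ?add0r.
rewrite (@tmap_combr _ _ _ _ _ _ (g \o f) idfun (linear_of pL) (-1)).
  by rewrite tmap_compr ft !linear0 add0r tmap_id.
by move=> u; rewrite /= addrC scaleN1r.
Qed.
End KernelProjection.

Section Coinvariants.
Variables (K : fieldType) (D : coalgType K) (W : lmodType K).
Variables (m : {linear D -> W}) (w : W).

(** Coinvariance z1 ⊗ m(z2) = z ⊗ w, written as the vanishing of a linear
    map so that [kernel_projection] applies. *)
Definition coinv_defect (z : D) : tensor D W := tmap idfun m (comul z) - z ⊗ w.
Lemma coinv_defect_linear : linear coinv_defect.
Proof.
move=> a x y; rewrite /coinv_defect !linearP /= tensDl tensZl opprD addrACA.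
by rewrite scalerBr.
Qed.
HB.instance Definition _ :=
  GRing.isLinear.Build K D (tensor D W) _ coinv_defect coinv_defect_linear.

Lemma coinv_defect0 z : coinv_defect z = 0 <-> tmap idfun m (comul z) = z ⊗ w.
Proof.
split=> [/eqP|zE]; first by rewrite subr_eq0 => /eqP.
by apply/eqP; rewrite subr_eq0 zE.
Qed.

Lemma coinv_subspace : subspace (fun z => tmap idfun m (comul z) = z ⊗ w).
Proof.
split=> [|a x y /coinv_defect0 x0 /coinv_defect0 y0]; apply/coinv_defect0.
  by rewrite linear0.
by rewrite linearP /= x0 y0 scaler0 addr0.
Qed.

(** Coassociativity: z1 ⊗ z2 ⊗ m(z3) - z1 ⊗ z2 ⊗ w is the image under
    Δ ⊗ id of the defect of z.  So the coproduct of a coinvariant element has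
    coinvariant right legs. *)
Lemma coinv_defect_comul z :
  coinv_defect z = 0 -> tmap idfun coinv_defect (comul z) = 0.
Proof.
move/coinv_defect0=> zE.
have wL : linear (fun z : D => z ⊗ w) by move=> a x y; rewrite tensDl tensZl.
rewrite (@tmap_combr _ _ _ _ _ _ (linear_of wL) (tmap idfun m \o comul)
  coinv_defect (-1)); last first.
  by move=> u; rewrite scaleN1r addrC.
rewrite tmap_compr -comulA -tassoc_tmap tmap_comp.
have -> : tmap (tmap idfun idfun \o comul) (m \o idfun) (comul z) =
   tmap comul idfun (tmap idfun m (comul z)).
  rewrite tmap_comp; apply: eq_tmap => // u; exact: tmap_id.
rewrite zE tmapE.
have wE t : tassoc (t ⊗ w) = tmap idfun (linear_of wL) t.
  elim/tensorW: t => [u v|x y ex ey]; first by rewrite tassocE tmapE.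
  by rewrite tensDl [LHS]linearD [RHS]linearD; congr (_ + _).
by rewrite wE scaleN1r addNr.
Qed.
End Coinvariants.

Section MoreCoinvariants.
Variables (K : fieldType) (C D : coalgType K).

(** An element of a tensor product of coalgebras is determined by the two
    projections of its coproduct; this is what makes a factorization through
    the doubly coinvariant tensors unique. *)
Lemma tensor_recover (z : tensor C D) :
  tmap (tcontractr counit) (tcontractl counit) (comul z) = z.
Proof.
have tE (s : tensor C C) (t : tensor D D) :
    tmap (tcontractr counit) (tcontractl counit) (tmid (s ⊗ t)) =
    tcontractr counit s ⊗ tcontractl counit t.
  elim/tensorW: s => [x x'|u v eu ev]; last first.
    by rewrite tensDl !linearD /= tensDl eu ev.
  elim/tensorW: t => [y y'|u v eu ev]; last first.
    by rewrite tensDr !linearD /= eu ev.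
  rewrite tmidE tmapE /= !tcontractrE !tcontractlE.
  by rewrite !tensZl !tensZr !scalerA mulrC.
elim/tensorW: z => [x y|u v eu ev]; last by rewrite !linearD /= eu ev.
rewrite -[comul (x ⊗ y)]/(tmid (tmap comul comul (x ⊗ y))) tmapE tE.
by rewrite -[tcontractr _ _]/(tlift _ _) -[tcontractl _ _]/(tlift _ _) counitr counitl.
Qed.

(** Apply ε to the first leg of z1 ⊗ m(z2) = z ⊗ w. *)
Lemma coinv_counit (W : lmodType K) (m : {linear D -> W}) (w : W) z :
  tmap idfun m (comul z) = z ⊗ w -> m z = counit z *: w.
Proof.
move=> zE; rewrite -[in LHS](counitl z) -[tlift _ _]/(tcontractl counit _).
rewrite -[RHS]tcontractlE -zE.
elim/tensorW: (comul z) => [u v|a b ea eb]; last by rewrite !linearD /= ea eb.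
by rewrite tmapE !tcontractlE linearZ.
Qed.

(** If m g is trivial and g is a coalgebra map, then
    g(x)1 ⊗ m(g(x)2) = g(x1) ⊗ m(g(x2)) = g(x) ⊗ 1. *)
Lemma coinv_image (A : algType K) (m : {linear D -> A}) (g : {linear C -> D}) :
  coalg_map g -> m \o g =1 conv_unit A ->
  forall x, tmap idfun m (comul (g x)) = g x ⊗ 1.
Proof.
move=> [gC _] mg x; rewrite gC tmap_comp.
have -> : tmap (idfun \o g) (m \o g) (comul x) = tmap g (conv_unit A) (comul x).
  exact: eq_tmap.
rewrite -[in RHS](counitr x) -[tlift _ _]/(tcontractr counit _).
elim/tensorW: (comul x) => [u v|a b ea eb].
  by rewrite tmapE tcontractrE /conv_unit /= tensZr linearZ tensZl.
by rewrite !linearD /= tensDl ea eb.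
Qed.

(** By cocommutativity, control over the right legs of a coproduct gives
    control over the left ones. *)
Lemma tmap_cocomm (p : {linear C -> C}) x : cocommutative C ->
  tmap idfun p (comul x) = comul x -> tmap p p (comul x) = comul x.
Proof.
move=> coC px.
have -> : tmap p p (comul x) = tmap p idfun (tmap idfun p (comul x)).
  by rewrite tmap_comp.
by rewrite px -[in LHS]coC -tswap_tmap px coC.
Qed.

Lemma tensor_cocommutative :
  cocommutative C -> cocommutative D -> cocommutative (tensor C D).
Proof.
move=> coC coD z.
have swapE (s : tensor C C) (t : tensor D D) :
    tswap (tmid (s ⊗ t)) = tmid (tswap s ⊗ tswap t).
  elim/tensorW: s => [a b|u v eu ev]; last first.
    by rewrite tensDl !linearD /= tensDl linearD eu ev.
  elim/tensorW: t => [a' b'|u v eu ev]; last by rewrite tensDr !linearD /= eu ev.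
  by rewrite tmidE !tswapE tmidE.
elim/tensorW: z => [x y|x y ex ey]; last by rewrite !linearD /= ex ey.
rewrite -[comul _]/(tmid (tmap comul comul (x ⊗ y))) tmapE swapE.
by rewrite coC coD.
Qed.

End MoreCoinvariants.

(** If m(c d) depends only on c and, linearly, on m(d), then coinvariance of
    the right factor of a product can be used under m; symmetrically for the
    left factor. *)
Section CoinvariantProduct.
Variables (K : fieldType) (A B : algType K) (m : {linear A -> B}).
Hypothesis m1 : m 1 = 1.

Lemma tmap_coinv_mull (s t : tensor A A) (w : A) :
  (forall c, exists L : {linear B -> B}, forall d, m (c * d) = L (m d)) ->
  tmap idfun m t = w ⊗ 1 ->
  tmap idfun m (s * t) = tmap (mul_right w) idfun (tmap idfun m s).
Proof.
move=> mL tw; elim/tensorW: s => [a c|s s' es es']; last first.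
  by rewrite mulrDl !linearD /= es es'.
have [L LE] := mL c.
have -> : tmap idfun m ((a ⊗ c) * t) = tmap (mul_left a) L (tmap idfun m t).
  elim/tensorW: t {tw} => [a' d|t t' et et'].
    by rewrite tensM !tmapE /= LE.
  by rewrite mulrDr !linearD /= et et'.
by rewrite tw !tmapE /= -m1 -LE mulr1.
Qed.

Lemma tmap_coinv_mulr (s t : tensor A A) (w : A) :
  (forall c, exists L : {linear B -> B}, forall d, m (d * c) = L (m d)) ->
  tmap idfun m s = w ⊗ 1 ->
  tmap idfun m (s * t) = tmap (mul_left w) idfun (tmap idfun m t).
Proof.
move=> mL sw; elim/tensorW: t => [a c|t t' et et']; last first.
  by rewrite mulrDr !linearD /= et et'.
have [L LE] := mL c.
have -> : tmap idfun m (s * (a ⊗ c)) = tmap (mul_right a) L (tmap idfun m s).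
  elim/tensorW: s {sw} => [a' d|s s' es es'].
    by rewrite tensM !tmapE /= LE.
  by rewrite mulrDl !linearD /= es es'.
by rewrite sw !tmapE /= -m1 -LE mul1r.
Qed.

End CoinvariantProduct.

(** * Hopf algebras carried by a subset of a bialgebra *)

(** What a subset of A needs in order to carry a Hopf algebra.  The projection
    [hs_proj] makes the tensor square of the subset a direct summand of that of
    A; the coproduct of A can then be projected to it, and identities on the
    subset follow from those on A by injectivity.  The antipode is the
    restriction of a linear endomorphism of A. *)
Record hopf_subset (K : fieldType) (A : bialgType K) := HopfSubset {
  hs_set : {pred A};
  hs_subalg : subalg_closed hs_set;
  hs_proj : {linear A -> A};
  hs_proj_in : forall x, hs_proj x \in hs_set;
  hs_proj_id : forall x, x \in hs_set -> hs_proj x = x;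
  hs_comul : forall x, x \in hs_set -> tmap hs_proj hs_proj (comul x) = comul x;
  hs_anti : {linear A -> A};
  hs_anti_in : forall x, x \in hs_set -> hs_anti x \in hs_set;
  hs_antil : forall x, x \in hs_set -> conv hs_anti idfun x = conv_unit A x;
  hs_antir : forall x, x \in hs_set -> conv idfun hs_anti x = conv_unit A x
}.

Section SubHopf.
Variables (K : fieldType) (A : bialgType K) (d : hopf_subset A).

HB.instance Definition _ :=
  GRing.isSubalgClosed.Build K A (hs_set d) (hs_subalg d).

Definition sub_hopf := {x : A | x \in hs_set d}.
HB.instance Definition _ := SubType.on sub_hopf.
HB.instance Definition _ := [Choice of sub_hopf by <:].
HB.instance Definition _ := [SubChoice_isSubAlgebra of sub_hopf by <:].

Definition sub_incl : sub_hopf -> A := val.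
Lemma sub_incl_linear : linear sub_incl.
Proof. by move=> a x y; rewrite /sub_incl linearP. Qed.
HB.instance Definition _ :=
  GRing.isLinear.Build K sub_hopf A _ sub_incl sub_incl_linear.

Definition sub_proj (x : A) : sub_hopf := Sub (hs_proj d x) (hs_proj_in d x).
Lemma sub_projK x : sub_incl (sub_proj x) = hs_proj d x.
Proof. exact: SubK. Qed.
Lemma sub_inclK : cancel sub_incl sub_proj.
Proof. by move=> x; apply: val_inj; rewrite SubK hs_proj_id //; apply: valP. Qed.
Lemma sub_proj_linear : linear sub_proj.
Proof. by move=> a x y; apply: val_inj; rewrite linearP !SubK linearP. Qed.
HB.instance Definition _ :=
  GRing.isLinear.Build K A sub_hopf _ sub_proj sub_proj_linear.

Definition sub_comul (x : sub_hopf) : tensor sub_hopf sub_hopf :=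
  tmap sub_proj sub_proj (comul (sub_incl x)).
Definition sub_counit (x : sub_hopf) : K := counit (sub_incl x).

Lemma sub_comul_linear : linear sub_comul.
Proof. by move=> a x y; rewrite /sub_comul !linearP. Qed.
HB.instance Definition _ :=
  GRing.isLinear.Build K sub_hopf (tensor sub_hopf sub_hopf) _ sub_comul sub_comul_linear.
Lemma sub_counit_scalar : scalar sub_counit.
Proof. by move=> a x y; rewrite /sub_counit !linearP. Qed.
HB.instance Definition _ :=
  GRing.isLinear.Build K sub_hopf K _ sub_counit sub_counit_scalar.

Lemma sub_incl_comul x : tmap sub_incl sub_incl (sub_comul x) = comul (sub_incl x).
Proof.
rewrite tmap_comp -[RHS](hs_comul (valP x)).
by apply: eq_tmap => y; apply: sub_projK.
Qed.

Lemma tmap_incl_inj : injective (tmap sub_incl sub_incl).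
Proof. exact: can_inj (tmapK sub_inclK sub_inclK). Qed.

Lemma sub_comulA x :
  tassoc (tmap sub_comul idfun (sub_comul x)) = tmap idfun sub_comul (sub_comul x).
Proof.
apply: (can_inj (tmapK sub_inclK (tmapK sub_inclK sub_inclK))).
have lE z : tmap (tmap sub_incl sub_incl) sub_incl (tmap sub_comul idfun z) =
    tmap comul idfun (tmap sub_incl sub_incl z).
  by rewrite !tmap_comp; apply: eq_tmap => // y /=; rewrite sub_incl_comul.
have rE z : tmap sub_incl (tmap sub_incl sub_incl) (tmap idfun sub_comul z) =
    tmap idfun comul (tmap sub_incl sub_incl z).
  by rewrite !tmap_comp; apply: eq_tmap => // y /=; rewrite sub_incl_comul.
by rewrite -tassoc_tmap lE rE sub_incl_comul comulA.
Qed.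

Lemma sub_counitl x : tlift (fun a b => sub_counit a *: b) (sub_comul x) = x.
Proof.
apply: (can_inj sub_inclK).
rewrite -[in RHS](counitl (sub_incl x)) -[tlift _ (comul _)]/(tcontractl counit _).
rewrite -[tlift _ _]/(tcontractl sub_counit _) -sub_incl_comul.
elim/tensorW: (sub_comul x) => [u v|y z ey ez]; last by rewrite !linearD /= ey ez.
by rewrite tmapE !tcontractlE linearZ.
Qed.

Lemma sub_counitr x : tlift (fun a b => sub_counit b *: a) (sub_comul x) = x.
Proof.
apply: (can_inj sub_inclK).
rewrite -[in RHS](counitr (sub_incl x)) -[tlift _ (comul _)]/(tcontractr counit _).
rewrite -[tlift _ _]/(tcontractr sub_counit _) -sub_incl_comul.
elim/tensorW: (sub_comul x) => [u v|y z ey ez]; last by rewrite !linearD /= ey ez.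
by rewrite tmapE !tcontractrE linearZ.
Qed.

HB.instance Definition _ := isCoalgebra.Build K sub_hopf
  sub_comul_linear sub_counit_scalar sub_comulA sub_counitl sub_counitr.

Lemma sub_inclM x y : sub_incl (x * y) = sub_incl x * sub_incl y.
Proof. by []. Qed.

Lemma sub_comul_monoid :
  monoid_morphism (comul : sub_hopf -> tensor sub_hopf sub_hopf).
Proof.
split=> [|x y]; apply: tmap_incl_inj.
  by rewrite [LHS]sub_incl_comul comul1 tens1 tmapE.
rewrite [LHS]sub_incl_comul [RHS](tmap_mul sub_inclM sub_inclM).
by rewrite sub_inclM comulM !sub_incl_comul.
Qed.

Lemma sub_counit_monoid : monoid_morphism (counit : sub_hopf -> K).
Proof. by split=> [|x y]; [exact: counit1|exact: counitM]. Qed.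

HB.instance Definition _ := Coalgebra_isBialgebra.Build K sub_hopf
  sub_comul_monoid sub_counit_monoid.

Definition sub_antipode (x : sub_hopf) : sub_hopf :=
  Sub (hs_anti d (sub_incl x)) (hs_anti_in (valP x)).
Lemma sub_incl_antipode x : sub_incl (sub_antipode x) = hs_anti d (sub_incl x).
Proof. exact: SubK. Qed.
Lemma sub_antipode_linear : linear sub_antipode.
Proof.
move=> a x y; apply: (can_inj sub_inclK).
by rewrite linearP !sub_incl_antipode !linearP.
Qed.
HB.instance Definition _ :=
  GRing.isLinear.Build K sub_hopf sub_hopf _ sub_antipode sub_antipode_linear.

Lemma sub_incl_conv (f g : {linear sub_hopf -> sub_hopf}) (f' g' : {linear A -> A}) x :
  (forall y, sub_incl (f y) = f' (sub_incl y)) ->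
  (forall y, sub_incl (g y) = g' (sub_incl y)) ->
  sub_incl (conv f g x) = conv f' g' (sub_incl x).
Proof.
move=> fE gE; rewrite -[LHS](conv_alg_map f g sub_inclM).
rewrite -[RHS]/(tmul (tmap f' g' (comul (sub_incl x)))) -sub_incl_comul tmap_comp.
by congr tmul; apply: eq_tmap => y /=.
Qed.

Lemma sub_antipodel x :
  tlift (fun a b => sub_antipode a * b) (comul x) = counit x *: 1.
Proof.
rewrite -[LHS]/(tlift (fun a b => sub_antipode a * idfun b) _) tlift_mul.
apply: (can_inj sub_inclK); rewrite -[tmul _]/(conv sub_antipode idfun x).
rewrite (@sub_incl_conv _ _ (hs_anti d) idfun) //.
by rewrite (hs_antil (valP x)) linearZ.
Qed.

Lemma sub_antipoder x :
  tlift (fun a b => a * sub_antipode b) (comul x) = counit x *: 1.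
Proof.
rewrite -[LHS]/(tlift (fun a b => idfun a * sub_antipode b) _) tlift_mul.
apply: (can_inj sub_inclK); rewrite -[tmul _]/(conv idfun sub_antipode x).
rewrite (@sub_incl_conv _ _ idfun (hs_anti d)) //.
by rewrite (hs_antir (valP x)) linearZ.
Qed.

HB.instance Definition _ := hasAntipode.Build K sub_hopf
  sub_antipode_linear sub_antipodel sub_antipoder.

Lemma sub_incl_bialg_map : is_bialg_map sub_incl.
Proof.
by split=> // x; apply/esym/sub_incl_comul.
Qed.

Lemma sub_hopf_cocommutative : cocommutative A -> cocommutative sub_hopf.
Proof.
move=> coA x; apply: tmap_incl_inj.
by rewrite -tswap_tmap sub_incl_comul coA.
Qed.

End SubHopf.

(** * The set of doubly coinvariant tensors *)

Section CofreeSet.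
Variables (K : fieldType) (B : bialgType K).
Local Notation A := (tensor B B^c).

Definition pswap : A -> A := @tswap K B B.
HB.instance Definition _ := GRing.isLinear.Build K A A _ pswap
  (linearP (@tswap K B B)).
Definition pmul : A -> B := @tmul K B.
HB.instance Definition _ := GRing.isLinear.Build K A B _ pmul (linearP (@tmul K B)).
Definition pmulop : A -> B := pmul \o pswap.
HB.instance Definition _ := GRing.Linear.on pmulop.

Lemma pswapE (x : B) (y : B^c) : pswap (x ⊗ y) = (y : B) ⊗ (x : B^c).
Proof. exact: (@tswapE K B B x y). Qed.
Lemma pmulE (x : B) (y : B^c) : pmul (x ⊗ y) = x * (y : B).
Proof. exact: (@tmulE K B x y). Qed.
Lemma pmulopE (x : B) (y : B^c) : pmulop (x ⊗ y) = (y : B) * x.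
Proof. by rewrite /pmulop /= pswapE pmulE. Qed.

Lemma pswapK : cancel pswap pswap.
Proof. exact: (@tswapK K B B). Qed.

Lemma pswap_coalg_map : coalg_map pswap.
Proof.
split=> z.
  have swapE (s : tensor B B) (t : tensor B^c B^c) :
      tmid ((t : tensor B B) ⊗ (s : tensor B^c B^c)) =
      tmap pswap pswap (tmid (s ⊗ t)).
    elim/tensorW: s => [x x'|u v eu ev]; last first.
      by rewrite tensDr tensDl !linearD /= eu ev.
    elim/tensorW: t => [y y'|u v eu ev]; last first.
      by rewrite tensDr tensDl !linearD /= eu ev.
    by rewrite [RHS](congr1 _ (tmidE _ _ _ _)) tmapE /= !pswapE; exact: tmidE.
  elim/tensorW: z => [x y|x y ex ey]; last by rewrite !linearD /= ex ey.
  rewrite pswapE -[LHS]/(tmid (tmap comul comul ((y : B) ⊗ (x : B^c)))).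
  rewrite -[RHS]/(tmap pswap pswap (tmid (tmap comul comul (x ⊗ y)))) !tmapE.
  exact: swapE.
elim/tensorW: z => [x y|x y ex ey]; last by rewrite !linearD /= ex ey.
by rewrite pswapE [LHS]tensor_counitE [RHS]tensor_counitE mulrC.
Qed.

(** Both conditions as coinvariance for linear maps out of the one coalgebra
    B ⊗ B^op.  For the second, the swap is an involutive coalgebra map and can
    be transported to the other side. *)
Lemma cofree_setE z : cofree_set z <->
  tmap idfun pmul (comul z) = z ⊗ 1 /\ tmap idfun pmulop (comul z) = z ⊗ 1.
Proof.
suff swapE : coinvariant (tswap (z : tensor B B)) <->
    tmap idfun pmulop (comul z) = z ⊗ 1.
  by split=> -[zC zC']; split=> //; apply/swapE.
rewrite /coinvariant -[tswap _]/(pswap z) -[comul _]/(comul (pswap z)).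
rewrite pswap_coalg_map.1.
rewrite -[tmap _ _ _]/(tmap idfun pmul (tmap pswap pswap (comul z))) tmap_comp.
have -> : tmap (idfun \o pswap) (pmul \o pswap) (comul z) =
    tmap pswap idfun (tmap idfun pmulop (comul z)) by rewrite tmap_comp.
split=> [|->]; last by rewrite tmapE.
have <- : tmap pswap idfun (z ⊗ (1 : B)) = pswap z ⊗ 1 by rewrite tmapE.
have := @tmapK K A A B B pswap pswap idfun idfun pswapK (fun _ => erefl).
by move=> /can_inj /[apply].
Qed.

(** pmul((x ⊗ y) d) = x pmul(d) y. *)
Lemma pmul_mull (c : A) :
  exists L : {linear B -> B}, forall d, pmul (c * d) = L (pmul d).
Proof.
elim/tensorW: c => [x y|c c' [L LE] [L' LE']]; last first.
  by exists (L \+ L') => d; rewrite mulrDl linearD /= LE LE'.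
exists (mul_left x \o mul_right (y : B)) => d.
elim/tensorW: d => [x' y'|d d' e e']; last by rewrite mulrDr !linearD /= e e'.
by rewrite tens_oppM !pmulE /= /mul_left /mul_right !mulrA.
Qed.

(** pmulop(d (x ⊗ y)) = y pmulop(d) x. *)
Lemma pmulop_mulr (c : A) :
  exists L : {linear B -> B}, forall d, pmulop (d * c) = L (pmulop d).
Proof.
elim/tensorW: c => [x y|c c' [L LE] [L' LE']]; last first.
  by exists (L \+ L') => d; rewrite mulrDr linearD /= LE LE'.
exists (mul_left (y : B) \o mul_right x) => d.
elim/tensorW: d => [x' y'|d d' e e']; last by rewrite mulrDl !linearD /= e e'.
by rewrite tens_oppM !pmulopE /= /mul_left /mul_right !mulrA.
Qed.

Lemma pmul1 : pmul 1 = 1.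
Proof. by rewrite tens1 pmulE mulr1. Qed.
Lemma pmulop1 : pmulop 1 = 1.
Proof. by rewrite tens1 pmulopE mulr1. Qed.

Lemma cofree_set1 : cofree_set (1 : A).
Proof.
by apply/cofree_setE; rewrite comul1 !tmapE /= pmul1 pmulop1.
Qed.

Lemma cofree_setM (z w : A) : cofree_set z -> cofree_set w -> cofree_set (z * w).
Proof.
move=> /cofree_setE[z1 z2] /cofree_setE[w1 w2]; apply/cofree_setE.
rewrite comulM (tmap_coinv_mull pmul1 _ pmul_mull w1).
by rewrite (tmap_coinv_mulr pmulop1 _ pmulop_mulr z2) z1 w2 !tmapE.
Qed.

Lemma cofree_setP (a : K) (z w : A) :
  cofree_set z -> cofree_set w -> cofree_set (a *: z + w).
Proof.
move=> /cofree_setE[z1 z2] /cofree_setE[w1 w2]; apply/cofree_setE.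
by split; apply: (coinv_subspace _ _).2.
Qed.

End CofreeSet.

Section CofreeHopfSubset.
Variables (K : fieldType) (B : bialgType K).
Hypothesis coB : cocommutative B.
Local Notation A := (tensor B B^c).

Lemma cocommA : cocommutative A.
Proof. exact: (@tensor_cocommutative K B B^c coB coB). Qed.

Definition cofree_mem : {pred A} := fun z => `[< cofree_set z >].

Lemma cofree_subalg : subalg_closed cofree_mem.
Proof.
split=> [|a z w /asboolP zC /asboolP wC|z w /asboolP zC /asboolP wC]; apply/asboolP.
- exact: cofree_set1.
- exact: cofree_setP.
- exact: cofree_setM.
Qed.

Lemma cofree_projection : exists p : {linear A -> A},
  [/\ forall z, cofree_set (p z), forall z, cofree_set z -> p z = z
    & forall z, cofree_set z -> tmap p p (comul z) = comul z].
Proof.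
pose f1 := coinv_defect (@pmul K B) 1; pose f2 := coinv_defect (@pmulop K B) 1.
have f0E z : cofree_set z <-> f1 z = 0 /\ f2 z = 0.
  apply: (iff_trans (cofree_setE z)).
  by split=> -[? ?]; split; apply/coinv_defect0.
have [p [pC p_id pt]] := kernel_projection f1 f2.
exists p; split=> [z|z /f0E[z1 z2]|z /f0E[z1 z2]].
- by apply/f0E; apply: pC.
- exact: p_id.
- apply: tmap_cocomm => //; first exact: cocommA.
  by apply: pt; apply: coinv_defect_comul.
Qed.

(** At x ⊗ y the left side is y1 x2 ⊗ y2 x1, which becomes y1 x1 ⊗ y2 x2
    because B is cocommutative. *)
(** At x ⊗ y the left side is x1 y2 ⊗ x2 y1, which becomes x1 y1 ⊗ x2 y2
    because B is cocommutative. *)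
Lemma pswap_conv_pmulop (z : A) :
  conv (@pswap K B) idfun z = tmap (@pmulop K B) (@pmulop K B) (comul z).
Proof.
have swapE (s : tensor B B) (t : tensor B^c B^c) :
    tmul (tmap (@pswap K B) idfun (tmid (tswap s ⊗ t))) =
    tmap (@pmulop K B) (@pmulop K B) (tmid (s ⊗ t)).
  elim/tensorW: s => [x x'|u v eu ev]; last first.
    by rewrite linearD !tensDl !linearD /= eu ev.
  elim/tensorW: t => [y y'|u v eu ev]; last first.
    by rewrite !tensDr !linearD /= eu ev.
  by rewrite tswapE !tmidE !tmapE /= pswapE !pmulopE tmulE [LHS]tens_oppM.
apply: (@tlift_unique K B B^c A (conv (@pswap K B) idfun)
  (tmap (@pmulop K B) (@pmulop K B) \o comul : {linear A -> tensor B B})) => x y.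
rewrite -[LHS]/(tmul (tmap (@pswap K B) idfun (tmid (tmap comul comul (x ⊗ y))))).
rewrite -[RHS]/(tmap _ _ (tmid (tmap comul comul (x ⊗ y)))) !tmapE -swapE.
by rewrite [tswap _]coB.
Qed.

Lemma pswap_conv_pmul (z : A) :
  conv idfun (@pswap K B) z = tmap (@pmul K B) (@pmul K B) (comul z).
Proof.
have swapE (s : tensor B B) (t : tensor B^c B^c) :
    tmul (tmap idfun (@pswap K B) (tmid (s ⊗ tswap t))) =
    tmap (@pmul K B) (@pmul K B) (tmid (s ⊗ t)).
  elim/tensorW: s => [x x'|u v eu ev]; last first.
    by rewrite !tensDl !linearD /= eu ev.
  elim/tensorW: t => [y y'|u v eu ev]; last first.
    by rewrite linearD !tensDr !linearD /= eu ev.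
  by rewrite tswapE !tmidE !tmapE /= pswapE !pmulE tmulE [LHS]tens_oppM.
apply: (@tlift_unique K B B^c A (conv idfun (@pswap K B))
  (tmap (@pmul K B) (@pmul K B) \o comul : {linear A -> tensor B B})) => x y.
rewrite -[LHS]/(tmul (tmap idfun (@pswap K B) (tmid (tmap comul comul (x ⊗ y))))).
rewrite -[RHS]/(tmap _ _ (tmid (tmap comul comul (x ⊗ y)))) !tmapE -swapE.
by rewrite [tswap _](coB y).
Qed.

End CofreeHopfSubset.

(** * The projection to B *)

Section Projection.
Variables (K : fieldType) (B : bialgType K).
Local Notation A := (tensor B B^c).

Definition cproj : A -> B := tcontractr counit.
HB.instance Definition _ := GRing.Linear.on cproj.

Lemma cprojE (x : B) (y : B^c) : cproj (x ⊗ y) = counit y *: x.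
Proof. exact: tcontractrE. Qed.

Lemma cproj_coalg_map : coalg_map cproj.
Proof.
split=> z; last first.
  elim/tensorW: z => [x y|u v eu ev]; last by rewrite !linearD /= eu ev.
  by rewrite cprojE linearZ [RHS]tensor_counitE mulrC.
have tE (s : tensor B B) (t : tensor B^c B^c) :
    tmap cproj cproj (tmid (s ⊗ t)) = counit (tcontractr counit t) *: s.
  elim/tensorW: s => [x x'|u v eu ev]; last first.
    by rewrite tensDl !linearD /= eu ev.
  elim/tensorW: t => [y y'|u v eu ev]; last first.
    by rewrite tensDr !linearD /= eu ev scalerDl.
  rewrite tmidE tmapE tcontractrE /= !cprojE tensZl tensZr scalerA mulrC.
  by rewrite [in RHS]linearZ.
elim/tensorW: z => [x y|u v eu ev]; last by rewrite !linearD /= eu ev.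
rewrite cprojE -[RHS]/(tmap cproj cproj (tmid (tmap comul comul (x ⊗ y)))).
rewrite tmapE tE -[tcontractr _ _]/(tlift _ _) counitr.
by rewrite linearZ.
Qed.

Lemma cproj_monoid : monoid_morphism cproj.
Proof.
split=> [|z w]; first by rewrite tens1 cprojE counit1 scale1r.
elim/tensorW: z => [x y|u v eu ev]; last by rewrite mulrDl !linearD /= eu ev mulrDl.
elim/tensorW: w => [x' y'|u v eu ev]; last by rewrite mulrDr !linearD /= eu ev mulrDr.
rewrite tens_oppM !cprojE -scalerAl -scalerAr scalerA; congr (_ *: _).
by rewrite mulrC; apply: (@counitM K B).
Qed.

Lemma cproj_pswap (z : A) : cproj (pswap z) = tcontractl counit z.
Proof.
apply: (@tlift_unique K B B^c B (cproj \o @pswap K B)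
  (tcontractl counit : {linear A -> B^c})) => x y.
by rewrite /= pswapE cprojE tcontractlE.
Qed.

Lemma cproj_bialg_map : is_bialg_map cproj.
Proof.
split; [exact: linearP|exact: cproj_monoid|exact: cproj_coalg_map.1|].
exact: cproj_coalg_map.2.
Qed.

End Projection.

Section CofreeData.
Variables (K : fieldType) (B : bialgType K).
Hypothesis coB : cocommutative B.
Local Notation A := (tensor B B^c).

Lemma cofree_set_pswap (z : A) : cofree_set z -> cofree_set (pswap z).
Proof.
move=> [zC zC']; split=> //.
by rewrite -[coinvariant _]/(coinvariant (pswap (pswap z) : tensor B B)) pswapK.
Qed.

Lemma tmap_coinv (m : {linear A -> B}) (z : A) :
  tmap idfun m (comul z) = z ⊗ 1 ->
  tmap m m (comul z) = counit z *: ((1 : B) ⊗ (1 : B)).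
Proof.
move=> zE; have -> : tmap m m (comul z) = tmap m idfun (tmap idfun m (comul z)).
  by rewrite tmap_comp.
by rewrite zE tmapE (coinv_counit zE) tensZl.
Qed.

(** The swap is an antipode: convolved with the identity it gives
    m(z1) ⊗ m(z2), for m = pmul or pmulop, and this is trivial by
    coinvariance. *)
Lemma cofree_hopf_subset : exists d : hopf_subset A,
  (forall z : A, cofree_set z <-> z \in hs_set d) /\ hs_anti d =1 @pswap K B.
Proof.
have [p [pC p_id pcomul]] := cofree_projection coB.
have memP (z : A) : reflect (cofree_set z) (z \in @cofree_mem K B) by apply: asboolP.
unshelve eexists (@HopfSubset K A (@cofree_mem K B) (@cofree_subalg K B) p
  _ _ _ (@pswap K B) _ _ _).
- by move=> z; apply/memP.
- by move=> z /memP; apply: p_id.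
- by move=> z /memP; apply: pcomul.
- by move=> z /memP zC; apply/memP; apply: cofree_set_pswap.
- move=> z /memP/cofree_setE[_ z2].
  by rewrite pswap_conv_pmulop // (tmap_coinv z2).
- move=> z /memP/cofree_setE[z1 _].
  by rewrite pswap_conv_pmul // (tmap_coinv z1).
by split=> // z; split=> /memP.
Qed.
End CofreeData.

(** * The universal property *)

Section Factorization.
Variables (K : fieldType) (B : bialgType K) (H : hopfAlgType K).
Hypothesis coH : cocommutative H.
Variable f : {linear H -> B}.
Hypothesis fM : monoid_morphism f.
Hypothesis fC : coalg_map f.
Local Notation A := (tensor B B^c).

(** The codomain is B^op because f S reverses products. *)
Definition fantipode : H -> B^c := f \o antipode.
HB.instance Definition _ := GRing.isLinear.Build K H B^c _ fantipode
  (linearP (f \o antipode)).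

(** x goes to f(x1) ⊗ f(S x2). *)
Definition cofree_factor : H -> A := tmap f fantipode \o comul.
HB.instance Definition _ := GRing.Linear.on cofree_factor.

Lemma fantipode_coalg_map : coalg_map fantipode.
Proof. exact: coalg_map_comp fC (cocomm_antipode_coalg_map coH). Qed.

Lemma cofree_factor_coalg_map : coalg_map cofree_factor.
Proof.
apply: coalg_map_comp; last exact: comul_coalg_map.
exact: coalg_map_tmap fC fantipode_coalg_map.
Qed.

Lemma cofree_factor_monoid : monoid_morphism cofree_factor.
Proof.
have [f1 fMul] := fM.
have fa1 : fantipode 1 = 1 by rewrite /fantipode /= antipode1 f1.
have faM : {morph fantipode : x y / x * y}.
  by move=> x y; rewrite /fantipode /= antipodeM fMul.
split=> [|x y]; rewrite /cofree_factor /=; first by rewrite comul1 tmapE /= f1 fa1.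
by rewrite comulM (tmap_mul fMul faM).
Qed.

(** f(x1) f(S x2) = f(x1 S x2) = ε(x). *)
Lemma pmul_factor : @pmul K B \o cofree_factor =1 conv_unit B.
Proof.
move=> x; have [f1 fMul] := fM.
rewrite -[LHS]/(conv f (f \o antipode) x).
rewrite -[conv _ _]/(conv (f \o idfun) (f \o antipode)) (conv_alg_map _ _ fMul) /=.
by rewrite conv_antipoder; apply: conv_unit_alg_map.
Qed.

(** The factors f(S x2) f(x1) come in the order of the antipode axiom once
    cocommutativity has exchanged x1 and x2. *)
Lemma pmulop_factor : @pmulop K B \o cofree_factor =1 conv_unit B.
Proof.
move=> x; have [f1 fMul] := fM.
rewrite -[LHS]/(tmul (tswap (tmap f (f \o antipode) (comul x)))).
rewrite tmul_swap_conv //.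
rewrite -[conv _ _]/(conv (f \o antipode) (f \o idfun)) (conv_alg_map _ _ fMul) /=.
by rewrite conv_antipodel; apply: conv_unit_alg_map.
Qed.

Lemma cofree_factor_in x : cofree_set (cofree_factor x).
Proof.
apply/cofree_setE; split.
  exact: (coinv_image cofree_factor_coalg_map pmul_factor).
exact: (coinv_image cofree_factor_coalg_map pmulop_factor).
Qed.

Lemma cproj_factor x : cproj (cofree_factor x) = f x.
Proof.
rewrite -[in RHS](counitr x) -[tlift _ _]/(tcontractr counit _) /cofree_factor /=.
elim/tensorW: (comul x) => [u v|a b ea eb]; last by rewrite !linearD /= ea eb.
by rewrite tmapE cprojE tcontractrE linearZ fantipode_coalg_map.2.
Qed.

(** Since g intertwines S with the swap, [tensor_recover] gives
    g(x) = p(g(x1)) ⊗ p(g(S x2)) = f(x1) ⊗ f(S x2), where p = [cproj]. *)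
Lemma cofree_factor_unique (g : {linear H -> A}) :
  coalg_map g -> (forall x, g (antipode x) = pswap (g x)) ->
  (forall x, cproj (g x) = f x) -> g =1 cofree_factor.
Proof.
move=> [gC _] gS gf x.
rewrite -[LHS](tensor_recover (g x)) gC tmap_comp.
apply: eq_tmap => y; first exact: gf.
by rewrite /= -cproj_pswap -gS gf.
Qed.

End Factorization.

Lemma bialg_mapP (K : fieldType) (A B : bialgType K) (f : A -> B) :
  is_bialg_map f -> exists F : {linear A -> B},
  [/\ f = F, monoid_morphism F & coalg_map F].
Proof. by case=> fL fM fC fe; exists (linear_of fL). Qed.

Lemma bialg_map_comp (K : fieldType) (A B C : bialgType K) (f : B -> C) (g : A -> B) :
  is_bialg_map f -> is_bialg_map g -> is_bialg_map (f \o g).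
Proof.
move=> /bialg_mapP[F [-> [F1 FM] FC]] /bialg_mapP[G [-> [G1 GM] GC]].
have [FGC FGe] := coalg_map_comp FC GC.
split=> //; first exact: (linearP (F \o G)).
by split=> [|x y]; rewrite /= ?G1 ?F1 ?GM ?FM.
Qed.

Theorem theorem3p29 (K : fieldType) (B : bialgType K)
    (cocommB : cocommutative B) :
  exists (C : hopfAlgType K) (i : C -> tensor B B^c),
    is_sub_bialgebra i (@cofree_set K B) /\
    is_cofree_cocomm_hopf (fun c => coinv_proj (i c : tensor B B)).
Proof.
have [d [dP dS]] := cofree_hopf_subset cocommB.
pose C : hopfAlgType K := sub_hopf d.
pose i : {linear C -> tensor B B^c} := @sub_incl K _ d.
have i_inj : injective i := can_inj (@sub_inclK K _ d).
have iC : coalg_map i by have [] := @sub_incl_bialg_map K _ d.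
have iM : monoid_morphism i by have [] := @sub_incl_bialg_map K _ d.
exists C, i; split.
  split=> [||z]; [exact: sub_incl_bialg_map|exact: i_inj|].
  split=> [/dP zd|[c <-]]; first by exists (Sub z zd); apply: SubK.
  by apply/dP; apply: (valP c).
split.
- exact: sub_hopf_cocommutative (cocommA cocommB).
- exact: bialg_map_comp (cproj_bialg_map B) (sub_incl_bialg_map d).
move=> H coH _ /bialg_mapP[f [-> fM fC]].
have g0C := cofree_factor_coalg_map coH fC.
have [g01 g0M] := cofree_factor_monoid fM.
have g0in x := cofree_factor_in coH fM fC x.
pose g : {linear H -> C} := @sub_proj K _ d \o cofree_factor f.
have ig x : i (g x) = cofree_factor f x.
  by rewrite [LHS]sub_projK hs_proj_id //; apply/dP; apply: g0in.
have gC : coalg_map g.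
  split=> x; last by rewrite -[LHS]iC.2 ig g0C.2.
  apply: tmap_incl_inj; rewrite sub_incl_comul [in LHS]ig g0C.1 tmap_comp.
  by apply: eq_tmap => y /=; rewrite ig.
have gM : monoid_morphism g.
  by split=> [|x y]; apply: i_inj; rewrite ?iM.1 ?iM.2 !ig.
exists g; split.
  split; last by move=> x /=; rewrite ig; apply: cproj_factor.
  split; last exact: bialg_map_antipode.
  by split; [exact: linearP|exact: gM|exact: gC.1|exact: gC.2].
move=> g' [[/bialg_mapP[G [-> GM GC]] GS] Gf].
apply/funext => x; apply: i_inj; rewrite ig.
apply: esym; apply: (@cofree_factor_unique K B H f (i \o G)) => [|y|y].
- exact: coalg_map_comp.
- by rewrite /= GS -dS; apply: sub_incl_antipode.
- exact: Gf.
Qed.
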